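(* Let $\pi:\mathcal X\to S$ be a proper holomorphic submersion over a domain $S\subset\mathbb C$. Fix a sign $\pm$, assume that $\pm K_{\mathcal X/S}$ is relatively ample, and let $\phi_t$ be weights on $\pm K_{\mathcal X/S}$ evolving according to the relative Kähler-Ricci flow in the non-normalized setting, $$\frac{\partial\phi_t}{\partial t}=\log\frac{(dd^c\phi_t)^n/n!}{e^{\pm\phi_t}}\quad\text{(fiber-wise)}.$$ Then $$\frac{\partial c(\phi_t)}{\partial t}=\Delta_{\omega_t^X}c(\phi_t)\mp c(\phi_t)+|A_{\phi_t}|^2_{\omega_t^X}$$ on $\mathcal X$. In particular, if $\phi_{KE}$ is a (smooth) weight on $\pm K_{\mathcal X/S}$ which is fiber-wise a normalized Kähler-Einstein weight, then $$\Delta_{\omega_{KE}}c(\phi_{KE})\mp c(\phi_{KE})+|A_{\omega_{KE}}|^2_{\omega_{KE}^X}=0,$$ where $A_{\omega_{KE}}:=A_{\phi_{KE}}$. (Upper signs correspond to $+K_{\mathcal X/S}$, lower signs to $-K_{\mathcal X/S}$.)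
   Context: $n$ is the relative dimension. A weight $\phi$ on a line bundle is a smooth Hermitian metric written locally as $e^{-\phi}$; $dd^c\phi=\frac{i}{2\pi}\partial\bar\partial\phi$. Weights on $\pm K_{\mathcal X/S}$ are smooth on $\mathcal X$ with strictly positive curvature along the fibers. The volume of $\pm K_{\mathcal X_s}$ is normalized, $\int_{\mathcal X_s}c_1(\pm K_{\mathcal X_s})^n/n!=1$. A weight $\phi$ on $\pm K_X$ induces a volume form on $X$, denoted $e^{\pm\phi}$: in local coordinates $z$, with $\phi$ the local function relative to the trivialization of $\pm K_X$ given by $dz_1\wedge\dots\wedge dz_n$ (respectively its dual), it is $e^{\pm\phi}\,i^{n^2}dz\wedge d\bar z$. A normalized Kähler-Einstein weight on $\pm K_X$ is a weight $\phi_{KE}$ with $e^{\pm\phi_{KE}}=\omega_{KE}^n/n!$, where $\omega_{KE}=dd^c\phi_{KE}$ (then a Kähler-Einstein metric). In local holomorphic coordinates $(z_1,\dots,z_n,s)$ with $\pi(z,s)=s$, subscripts denoting partial derivatives and $(\phi^{i\bar j})$ the inverse of the fiber-wise Hessian $(\phi_{i\bar j})$: $\omega_t^X$ is the fiber-wise restriction of $dd^c\phi_t$ and $\Delta_{\omega_t^X}u=\phi_t^{i\bar j}u_{i\bar j}$; similarly for $\omega_{KE}$. $c(\phi)$ is $\phi_{s\bar s}$ minus the squared norm of $\bar\partial_X\phi_s$ with respect to the metric $(\phi_{i\bar j})$ (a global function on $\mathcal X$, proportional to $(dd^c\phi)^{n+1}/((d_Xd_X^c\phi)^n\wedge i\,ds\wedge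 d\bar s)$). $V_\phi$ is the local $(1,0)$ vector field along the fibers determined by $\phi_{i\bar j}V_\phi^i=\phi_{s\bar j}$, and $A_\phi:=-\bar\partial_XV_\phi$, a globally defined $(0,1)$-form on $\mathcal X_s$ with values in $T^{1,0}\mathcal X_s$ representing the Kodaira-Spencer class of $\partial/\partial s$; $|A_\phi|_{\omega^X}$ is its pointwise norm with respect to the fiber metric. *)

(* Defs.v *)
From HB Require Import structures.
From mathcomp Require Import all_boot all_order all_algebra.
From mathcomp Require Import complex.
From mathcomp Require Import all_classical all_reals all_analysis.

Set Implicit Arguments.
Unset Strict Implicit.
Unset Printing Implicit Defensive.

Import Order.TTheory GRing.Theory Num.Theory.
Import numFieldNormedType.Exports.

Local Open Scope classical_set_scope.
Local Open Scope ring_scope.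
Local Open Scope complex_scope.

(* The library equips abstract numeric fields with their topology, but not the
   concrete type R[i]. *)
HB.instance Definition _ (R : realType) := PseudoPointedMetric.copy R[i] R[i]^o.
HB.instance Definition _ (R : realType) := NormedModule.copy R[i] R[i]^o.

(* The model space C^n x C of the total space, with coordinates (z, s). *)
Notation model R n := ('rV[R[i]]_n * R[i])%type.

Section Calculus.
Context {R : realType} {n : nat}.
Local Notation C := R[i].
Local Notation E := (model R n).
Implicit Types (f : E -> C) (F : R -> E -> C) (v p : E) (I : set R).

(* Real directional derivative of a complex-valued function; [v] ranges over
   C^n x C regarded as a real vector space. *)
Definition rquot v f p (h : R) : C := (f (p + h%:C *: v) - f p) / h%:C.
Definition rderivable v f p := cvg (rquot v f p h @[h --> 0^']).
Definition rderive v f p : C := lim (rquot v f p h @[h --> 0^']).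

(* Wirtinger derivatives along a complex coordinate direction. *)
Definition dz v f p : C := (rderive v f p - 'i * rderive ('i *: v) f p) / 2%:R.
Definition dzb v f p : C := (rderive v f p + 'i * rderive ('i *: v) f p) / 2%:R.

Definition ez (j : 'I_n) : E := (delta_mx 0 j, 0).
Definition es : E := (0, 1).

(* Time derivatives are taken within the time interval [I], hence one-sided at
   an end point belonging to [I]. *)
Definition near_time I (t : R) := within [set h | I (t + h)] 0^'.
Definition tquot (g : R -> C) (t h : R) : C := (g (t + h) - g t) / h%:C.
Definition has_tderive I (g : R -> C) t (l : C) :=
  tquot g t h @[h --> near_time I t] --> l.

(* A direction is [None] for time, [Some v] for the spatial direction [v]. *)
Definition jderivable I (d : option E) F t p : Prop :=
  if d is Some v then rderivable v (F t) p
  else cvg (tquot (F ^~ p) t h @[h --> near_time I t]).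
Definition jderive I (d : option E) F : R -> E -> C :=
  if d is Some v then fun t => rderive v (F t)
  else fun t p => lim (tquot (F ^~ p) t h @[h --> near_time I t]).

(* Joint C^oo smoothness on I x U. *)
Definition jsmooth I (U : set E) F := forall ds : seq (option E),
  let G := foldr (jderive I) F ds in
  (forall d t p, I t -> U p -> jderivable I d G t p) /\
  {within I `*` U, continuous (fun q : R * E => G q.1 q.2)}.

(* hess u = (u_{i jbar}) *)
Definition hess f p : 'M[C]_n := \matrix_(i, j) dz (ez i) (dzb (ez j) f) p.

(* hinv f = (f^{i jbar}), normalized by f^{i jbar} f_{k jbar} = delta^i_k;
   hence the transpose. *)
Definition hinv f p : 'M[C]_n := (invmx (hess f p))^T.

Definition laplacian f (u : E -> C) p : C :=
  \sum_i \sum_j hinv f p i j * hess u p i j.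

(* f_{s jbar}, the coefficients of dbar_X f_s *)
Definition dbar_s f p (j : 'I_n) : C := dz es (dzb (ez j) f) p.

Definition c_of f p : C :=
  dz es (dzb es f) p
  - \sum_i \sum_j hinv f p i j * dbar_s f p j * (dbar_s f p i)^*.

Definition V_of f p (i : 'I_n) : C := \sum_j hinv f p i j * dbar_s f p j.

(* [A_of f p i j] is the coefficient of dzbar_j (x) d/dz_i. *)
Definition A_of f p (i j : 'I_n) : C := - dzb (ez j) (V_of f ^~ i) p.

Definition normA2 f p : C :=
  \sum_i \sum_j \sum_k \sum_l
    hess f p i k * hinv f p l j * A_of f p i j * (A_of f p k l)^*.

(* The density of (dd^c f)^n / n! with respect to i^{n^2} dz /\ dzbar, which
   equals (i dz_1 /\ dzbar_1) /\ ... /\ (i dz_n /\ dzbar_n); here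
   dd^c f = i/(2 pi) sum_{i,j} f_{i jbar} dz_i /\ dzbar_j. *)
Definition MA_density f p : R :=
  complex.Re (\det (((2%:R * pi)^-1)%:C *: hess f p)).

Definition posdef (H : 'M[C]_n) :=
  forall v : 'rV[C]_n, v != 0 -> 0 < \sum_i \sum_j H i j * v 0 i * (v 0 j)^*.

End Calculus.

(* Lebesgue integral over C^n = R^{2n} of a compactly supported function that is
   continuous on C^n, as an iterated integral. *)
Fixpoint integral_Cn (R : realType) (n : nat) : ('rV[R[i]]_n -> R) -> R :=
  match n with
  | 0 => fun g => g 0
  | m.+1 => fun g =>
      \int[@lebesgue_measure R]_x \int[@lebesgue_measure R]_y
        integral_Cn (fun w : 'rV[R[i]]_m =>
          g (row_mx (((x : R) +i* (y : R))%:M : 'rV_1) w))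
  end.

Section Family.
Context {R : realType} {n : nat} {X : topologicalType}.
Local Notation C := R[i].
Local Notation E := (model R n).

Record chart := Chart { dom : set X; crd : X -> E; icrd : E -> X }.
Implicit Types (a b : chart) (A : set chart) (pi : X -> C) (S : set C).

Definition img a : set E := crd a @` dom a.

Definition is_chart a :=
  [/\ open (dom a), open (img a), (forall x, dom a x -> icrd a (crd a x) = x),
      {within dom a, continuous (crd a)} & {within img a, continuous (icrd a)}].

(* [differentiable] is over the scalar field C, i.e. complex differentiability. *)
Definition holomorphic_change a b :=
  forall x, dom a x -> dom b x -> differentiable (crd b \o icrd a) (crd a x).

Definition complex_manifold A :=
  [/\ hausdorff_space X, @second_countable X, (forall a, A a -> is_chart a),
      (forall x, exists2 a, A a & dom a x) &
      (forall a b, A a -> A b -> holomorphic_change a b)].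

Definition proper_submersion A pi S :=
  [/\ (forall x, S (pi x)),
      (forall a p, A a -> img a p -> differentiable (pi \o icrd a) p),
      (forall a p, A a -> img a p -> exists v, 'D_v (pi \o icrd a) p != 0) &
      (forall K, compact K -> K `<=` S -> compact (pi @^-1` K))].

Definition domain S := [/\ open S, connected S & S !=set0].

(* Local holomorphic coordinates (z, s) on X with pi(z, s) = s. *)
Definition adapted A pi a :=
  [/\ is_chart a,
      (forall b, A b -> holomorphic_change a b /\ holomorphic_change b a) &
      (forall x, dom a x -> (crd a x).2 = pi x)].

(* Jacobian determinant of z_b with respect to z_a along the fibers. *)
Definition jac a b (x : X) : C :=
  \det (\matrix_(i < n, j < n)
    'D_(ez j) (fun p : E => (crd b (icrd a p)).1 0 i : C) (crd a x)).

(* The line bundle is +K for [true] and -K for [false]. *)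
Definition pm (e : bool) : int := if e then 1 else -1.

(* A local representative in every adapted chart. *)
Definition local_fun (T : Type) := chart -> E -> T.

Definition toC (phi : local_fun R) a (p : E) : C := (phi a p)%:C.

(* A smooth family of weights on +-K_{X/S}, positively curved along the fibers:
   [phi t a] is the local function -log |e|^2, where e is the trivialization
   dz_a (resp. its dual). *)
Definition weights A pi (e : bool) (I : set R) (phi : R -> local_fun R) :=
  [/\ (forall a, adapted A pi a -> jsmooth I (img a) (fun t => toC (phi t) a)),
      (forall t a p, I t -> adapted A pi a -> img a p ->
         posdef (hess (toC (phi t) a) p)) &
      (forall t a b x, I t -> adapted A pi a -> adapted A pi b ->
         dom a x -> dom b x ->
         phi t b (crd b x) = phi t a (crd a x)
           - (pm e)%:~R * ln (ComplexField.Normc.normc (jac a b x) ^+ 2))].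

(* A time-independent weight is a constant family. *)
Definition weight A pi (e : bool) (phi : local_fun R) :=
  weights A pi e [set: R] (fun=> phi).

(* Holomorphic sections of (+-K_{X_s})^{(x) k}: [f a] is the coefficient of
   dz_a^{(x) +-k} on the slice of the chart [a] at [s]. *)
Definition fiber_section A pi (e : bool) (k : nat) (s : C)
    (f : chart -> 'rV[C]_n -> C) :=
  (forall a z, adapted A pi a -> img a (z, s) -> differentiable (f a) z) /\
  (forall a b x, adapted A pi a -> adapted A pi b -> dom a x -> dom b x ->
     pi x = s ->
     f a (crd a x).1 = jac a b x ^ (pm e * k%:Z)%R * f b (crd b x).1).

(* The sections embed the compact fiber into projective space: no base points,
   separation of points and of tangent vectors. *)
Definition fiber_very_ample A pi (e : bool) (k : nat) (s : C) :=
  [/\ (forall a x, adapted A pi a -> dom a x -> pi x = s ->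
         exists2 f, fiber_section A pi e k s f & f a (crd a x).1 != 0),
      (forall a b x y, adapted A pi a -> adapted A pi b -> dom a x -> dom b y ->
         pi x = s -> pi y = s -> x <> y ->
         exists2 f, fiber_section A pi e k s f &
           f a (crd a x).1 = 0 /\ f b (crd b y).1 != 0) &
      (forall a x (v : 'rV[C]_n), adapted A pi a -> dom a x -> pi x = s ->
         v != 0 ->
         exists2 f, fiber_section A pi e k s f &
           f a (crd a x).1 = 0 /\ 'D_v (f a) (crd a x).1 != 0)].

(* For a proper submersion, relative ampleness is ampleness on every fiber. *)
Definition relatively_ample A pi S (e : bool) :=
  forall s, S s -> exists2 k, (0 < k)%N & fiber_very_ample A pi e k s.

(* Integral over the fiber X_s of the volume form rho_a i^{n^2} dz /\ dzbar,
   computed with a partition of unity [w] subordinate to adapted charts; the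
   form i^{n^2} dz /\ dzbar is 2^n times Lebesgue measure on C^n. *)
Definition fiber_integral A pi (s : C) (rho : local_fun R) (v : R) :=
  exists m (a : 'I_m -> chart) (w : 'I_m -> X -> R),
  [/\ (forall l, [/\ adapted A pi (a l), continuous (w l) &
         exists K, [/\ compact K, K `<=` dom (a l) &
                       forall x, ~ K x -> w l x = 0]]),
      (forall x, pi x = s -> \sum_l w l x = 1) &
      v = \sum_l integral_Cn
        ((fun z => w l (icrd (a l) (z, s)) * (2%:R ^+ n * rho (a l) (z, s)))
           \_ [set z | img (a l) (z, s)])].

(* int_{X_s} c_1(+-K_{X_s})^n / n! = 1, with c_1 represented by the curvature
   form dd^c psi of any weight psi. *)
Definition normalized_volume A pi S (e : bool) :=
  forall s psi, S s -> weight A pi e psi ->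
    fiber_integral A pi s (fun a => MA_density (toC psi a)) 1.

(* e^{+-phi}, as a density with respect to i^{n^2} dz /\ dzbar. *)
Definition exp_density (e : bool) (phi : local_fun R) a (p : E) : R :=
  expR ((pm e)%:~R * phi a p).

Definition relative_KRF A pi (e : bool) (I : set R) (phi : R -> local_fun R) :=
  forall t a p, I t -> adapted A pi a -> img a p ->
    has_tderive I (fun tau => toC (phi tau) a p) t
      (ln (MA_density (toC (phi t) a) p / exp_density e (phi t) a p))%:C.

Definition normalized_KE A pi (e : bool) (phi : local_fun R) :=
  forall a p, adapted A pi a -> img a p ->
    exp_density e phi a p = MA_density (toC phi a) p.

End Family.

Arguments chart : clear implicits.

(* Main.v *)
Require Import Defs.
From HB Require Import structures.
From mathcomp Require Import all_boot all_order all_fingroup all_algebra.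
From mathcomp Require Import complex ring lra.
From mathcomp Require Import all_classical all_reals all_analysis.
Import Order.TTheory GRing.Theory Num.Theory.
Import numFieldNormedType.Exports.
Local Open Scope classical_set_scope.
Local Open Scope ring_scope.
Local Open Scope complex_scope.

Set Implicit Arguments.
Unset Strict Implicit.
Unset Printing Implicit Defensive.

(* Write [W = d/ds - V], where [V] is the vertical lift determined by
   [f_{i jbar} V^i = f_{s jbar}]. Then [c(f) = f_{a bbar} W^a conj(W^b)], and [W] is
   orthogonal to the fibers, so that any derivation [D] satisfies
   [D c = (D f_{a bbar}) W^a conj(W^b)]: the derivatives of [W] drop out. For
   [D = d/dt] the flow equation gives [dc/dt] as the form
   [d_a dbar_b (log det (f_{i jbar}) -+ f)] evaluated on [W]. For [D = dbar_l],
   followed by [d_k], it gives the trace [Delta c]. Both are expanded with Jacobi's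
   formula; since mixed partial derivatives commute, the terms with fourth
   derivatives and the one coming from the fibrewise derivatives d_k W agree, and
   the only remaining term is the one containing [dbar_l W], which is [|A|^2].
   A Kaehler-Einstein weight is a stationary solution of the flow. *)

(** * Derivations *)

(** Three kinds of derivative obey the same rules here: in time, one-sided at an end point belonging
    to [I]; along a real direction; and along d/dz or d/dzbar. Hence the calculus is set up once,
    for an abstract [is_derivation]. A Wirtinger derivative does not commute with conjugation, which
    exchanges d and dbar. So W and its conjugate enter the algebra as two independent lifts of a
    matrix without symmetry; Hermitian symmetry is used only to get positive determinants and to
    match the result with [c_of] and [normA2]. Since d/ds has constant coefficients, A = -dbar V is
    the same as dbar W. The smoothness hypothesis only supplies continuous iterated real partial
    derivatives on [I] times [U]. That they commute, time included, is proved from the mean value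
    theorem. *)

Section ComplexLimits.
Context {R : realType} {T : Type} {F : set_system T} {FF : Filter F}.
Local Notation C := R[i].

Lemma cvg_RtoC (f : T -> R) (a : R) :
  f @ F --> a -> (fun x => (f x)%:C : C) @ F --> (a%:C : C).
Proof.
move=> /cvgrPdist_lt H; apply/cvgrPdist_lt => -[e e'] /=.
rewrite ltcE /= => /andP[/eqP -> e0].
have := H e e0; apply: filterS => x hx.
by rewrite -rmorphB /= normc_def /= expr0n /= addr0 sqrtr_sqr ltcR.
Qed.

Lemma cvg_Re (f : T -> C) (a : C) :
  f @ F --> a -> (fun x => complex.Re (f x)) @ F --> complex.Re a.
Proof.
move=> /cvgrPdist_lt H; apply/cvgrPdist_lt => e e0.
have := H e%:C; rewrite ltcR => /(_ e0); apply: filterS => x hx.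
by rewrite -ltcR; apply: le_lt_trans hx; rewrite -raddfB normc_ge_Re.
Qed.

Lemma cvg_conjc (f : T -> C) (a : C) :
  f @ F --> a -> (fun x => (f x)^*) @ F --> a^*.
Proof.
move=> /cvgrPdist_lt H; apply/cvgrPdist_lt => e e0.
by have := H e e0; apply: filterS => x; rewrite -rmorphB norm_conjC.
Qed.

Lemma cvg_Im (f : T -> C) (a : C) :
  f @ F --> a -> (fun x => complex.Im (f x)) @ F --> complex.Im a.
Proof.
move=> fa.
have ImE (z : C) : complex.Im z = complex.Re (- 'i * z).
  by case: z => x y; rewrite mulNr /= mul0r mul1r sub0r opprK.
rewrite ImE (eq_cvg _ _ (fun x => ImE (f x))).
apply: cvg_Re; apply: cvgM fa; exact: cvg_cst.
Qed.

End ComplexLimits.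

Section Derivation.
Context {R : realType}.
Local Notation C := R[i].

(* [H f l]: the function [f] has derivative [l] at the point [p]; only the values
   of [f] on [U] matter. *)
Record is_derivation (T : Type) (U : set T) (p : T)
    (H : (T -> C) -> C -> Prop) : Prop := IsDerivation {
  drv_uniq : forall f l l', H f l -> H f l' -> l = l' ;
  drv_eq : forall f g l, (forall x, U x -> f x = g x) -> H f l -> H g l ;
  drv_cst : forall c, H (fun=> c) 0 ;
  drvD : forall f g l m, H f l -> H g m -> H (fun x => f x + g x) (l + m) ;
  drvM : forall f g l m, H f l -> H g m ->
    H (fun x => f x * g x) (l * g p + f p * m) ;
  drvV : forall f l, f p != 0 -> H f l ->
    H (fun x => (f x)^-1) (- l / f p ^+ 2) ;
  drv_ln : forall (f : T -> C) (l : C), (forall x, U x -> 0 < f x) -> H f l ->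
    H (fun x => (ln (complex.Re (f x)))%:C) (l / f p) }.

Section Curve.
Context {T : Type} (U : set T) (p : T) (gam : R -> T) (F : set_system R)
  {FF : ProperFilter F}.
Hypotheses (Up : U p) (Ugam : \forall h \near F, U (gam h))
  (F0 : (fun h : R => h) @ F --> (0 : R)) (Fn0 : \forall h \near F, h != 0).

Definition curve_quot (f : T -> C) (h : R) : C := (f (gam h) - f p) / h%:C.
Definition curve_drv f (l : C) := curve_quot f @ F --> l.

Lemma curve_drv_cvg f l : curve_drv f l -> (fun h => f (gam h)) @ F --> f p.
Proof.
move=> fl.
have : (fun h => curve_quot f h * h%:C + f p) @ F --> l * 0%:C + f p.
  by apply: cvgD (cvg_cst _); apply: cvgM fl (cvg_RtoC F0).
rewrite mulr0 add0r; apply: cvg_trans; apply: near_eq_cvg.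
apply: filterS Fn0 => h h0; rewrite /curve_quot mulrVK ?subrK //.
by rewrite unitfE (eq_complex h%:C 0) /= negb_and h0.
Qed.

Lemma curve_drv_near f g l : (forall x, U x -> f x = g x) ->
  curve_drv f l -> curve_drv g l.
Proof.
move=> fg; apply: cvg_trans; apply: near_eq_cvg.
by apply: filterS Ugam => h Uh; rewrite /curve_quot !fg.
Qed.

(** The slope of ln is completed by its limit at [r]: in the chain rule below, the function may take
    the value [r] again at nonzero times, where the bare quotient would be 0. *)
Lemma cvg_ln_slope (r : R) : 0 < r ->
  (fun y => if y == r then r^-1 else (ln y - ln r) / (y - r)) @ r --> r^-1.
Proof.
move=> r0; have := is_derive1_ln r0 => -[dv /= dE].
apply/cvgrPdist_lt => e e0.
have := dv; rewrite /derivable => /(cvgrPdist_lt) /(_ e e0).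
rewrite [lim _]dE => /nbhs_ballP[d /= d0 H].
exists d => //= y; rewrite /ball /= => yr.
case: eqP => [_|/eqP yr0]; first by rewrite subrr normr0.
have := H (y - r); rewrite /ball /= sub0r normrN distrC => /(_ yr).
rewrite subr_eq0 => /(_ yr0); rewrite /GRing.scale /= mulr1 subrK.
by rewrite mulrC.
Qed.

(** Used for [p + h v] with [h] tending to 0, and for [t + h] with [h] restricted to the time
    interval. The curve itself need not converge: a difference quotient with a limit already forces
    [f (gam h)] to tend to [f p]. *)
Lemma curve_is_derivation : is_derivation U p curve_drv.
Proof.
split.
- by move=> f l l' fl; apply: (cvg_unique _ fl); exact: norm_hausdorff.
- exact: curve_drv_near.
- move=> c; rewrite /curve_drv /curve_quot (_ : (fun _ => _) = fun=> 0) //.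
    exact: cvg_cst.
  by apply/funext => h; rewrite subrr mul0r.
- move=> f g l m fl gm; rewrite /curve_drv.
  rewrite (_ : curve_quot _ = fun h => curve_quot f h + curve_quot g h).
    exact: cvgD fl gm.
  by apply/funext => h; rewrite /curve_quot -mulrDl opprD addrACA.
- move=> f g l m fl gm; rewrite /curve_drv.
  rewrite (_ : curve_quot _ =
      fun h => curve_quot f h * g (gam h) + f p * curve_quot g h).
    apply: cvgD; first exact: cvgM fl (curve_drv_cvg gm).
    by apply: cvgM gm; exact: cvg_cst.
  by apply/funext => h; rewrite /curve_quot; ring.
- move=> f l fp0 fl; rewrite /curve_drv.
  have fc := curve_drv_cvg fl.
  have : (fun h => - curve_quot f h * (f (gam h) * f p)^-1) @ F -->
      - l * (f p * f p)^-1.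
    apply: cvgM (cvgN fl) (cvgV _ (cvgM fc (cvg_cst _))).
    by rewrite mulf_neq0.
  rewrite expr2; apply: cvg_trans; apply: near_eq_cvg.
  have fn0 : \forall h \near F, f (gam h) != 0.
    move/cvgrPdist_lt: fc => /(_ `|f p|); rewrite normr_gt0 => /(_ fp0).
    apply: filterS => h; apply: contraTneq => ->.
    by rewrite subr0 ltxx.
  apply: filterS2 Fn0 fn0 => h h0 fh0; rewrite /curve_quot.
  by field; rewrite fh0 fp0 /= (eq_complex h%:C 0) /= negb_and h0.
- move=> f l f0 fl; rewrite /curve_drv.
  have fc := curve_drv_cvg fl.
  have fR x : U x -> f x = (complex.Re (f x))%:C /\ 0 < complex.Re (f x).
    move=> /f0; case: (f x) => a b /=; rewrite ltcE /= => /andP[/eqP ->].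
    by [].
  have [fpE fp0] := fR _ Up.
  have qc := cvg_RtoC (cvg_comp _ _ (cvg_Re fc) (cvg_ln_slope fp0)).
  (* Chain rule: the quotient of ln f is the quotient of f times the completed slope at
     [f (gam h)]. *)
  have := cvgM fl (qc FF FF); rewrite fmorphV /= -fpE => /(_ FF); apply: cvg_trans.
  apply: near_eq_cvg; apply: filterS Ugam => h /fR [fhE fh0].
  rewrite /curve_quot /= fhE fpE /= -!rmorphB /=.
  case: eqP => [->|/eqP ne]; first by rewrite !subrr !mul0r.
  rewrite mulrAC -rmorphM /= [X in X%:C]mulrC divfK //.
  by rewrite subr_eq0.
Qed.

End Curve.

End Derivation.

Section DerivationTheory.
Context {R : realType} (T : Type) (U : set T) (p : T)
  (H : (T -> R[i]) -> R[i] -> Prop).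
Hypotheses (Up : U p) (HD : is_derivation U p H).
Local Notation C := R[i].

Lemma drvZ (c : C) (f : T -> C) l : H f l -> H (fun x => c * f x) (c * l).
Proof.
by move=> fl; have := drvM HD (drv_cst HD c) fl; rewrite mul0r add0r.
Qed.

Lemma drvN (f : T -> C) l : H f l -> H (fun x => - f x) (- l).
Proof.
move=> fl; rewrite -mulN1r; apply: (drv_eq HD _ (drvZ (-1) fl)) => x _.
by rewrite mulN1r.
Qed.

Lemma drvB (f g : T -> C) l m :
  H f l -> H g m -> H (fun x => f x - g x) (l - m).
Proof. by move=> fl gm; exact: (drvD HD fl (drvN gm)). Qed.

Lemma drv_sum (I : Type) (r : seq I) (f : I -> T -> C) (l : I -> C) :
  (forall i, H (f i) (l i)) ->
  H (fun x => \sum_(i <- r) f i x) (\sum_(i <- r) l i).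
Proof.
move=> fl; elim: r => [|i r IH].
  by rewrite big_nil; apply: (drv_eq HD _ (drv_cst HD 0)) => x; rewrite big_nil.
rewrite big_cons; apply: (drv_eq HD _ (drvD HD (fl i) IH)) => x _.
by rewrite big_cons.
Qed.

(** Summand [k] is the product with its factor [k] differentiated, written with a conditional so
    that in a determinant it becomes the replacement of row [k]. Without [uniq r] the condition
    [i == k] could select several factors. *)
Lemma drv_prod (I : eqType) (r : seq I) (f : I -> T -> C) (l : I -> C) :
  uniq r -> (forall i, H (f i) (l i)) ->
  H (fun x => \prod_(i <- r) f i x)
    (\sum_(k <- r) \prod_(i <- r) (if i == k then l i else f i p)).
Proof.
move=> + fl; elim: r => [_|j r IH /= /andP[jr /IH {}IH]].
  by rewrite big_nil; apply: (drv_eq HD _ (drv_cst HD 1)) => x; rewrite big_nil.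
have := drvM HD (fl j) IH.
set L := (X in H _ X); set L' := (X in _ -> H _ X).
suff -> : L = L' by apply: (drv_eq HD) => x _; rewrite big_cons.
rewrite {}/L {}/L' big_cons big_cons eqxx; congr (_ * _ + _).
  apply: eq_big_seq => i ir; case: eqP => // ij.
  by rewrite -ij ir in jr.
rewrite mulr_sumr; apply: eq_big_seq => k kr; rewrite big_cons.
by case: eqP => // jk; rewrite jk kr in jr.
Qed.

(* Jacobi's formula *)
Lemma drv_det n (M : T -> 'M[C]_n) (L : 'M[C]_n) :
  (forall i j, H (fun x => M x i j) (L i j)) ->
  H (fun x => \det (M x)) (\sum_i \sum_j L i j * cofactor (M p) i j).
Proof.
move=> ML.
have : H (fun x => \det (M x)) (\sum_(s : 'S_n) (-1) ^+ s *
    \sum_k \prod_i (if i == k then L i (s i) else M p i (s i))).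
  apply: drv_sum => s; apply: drvZ.
  by apply: (@drv_prod _ _ (fun i x => M x i (s i)) (fun i => L i (s i)));
    [exact: index_enum_uniq|].
congr H; under eq_bigr do rewrite mulr_sumr.
rewrite exchange_big; apply: eq_bigr => k _ /=.
(* [N] is [M p] with row [k] taken from [L]; its cofactors along row [k] are those of [M p]. *)
pose N := \matrix_(i, j) (if i == k then L i j else M p i j).
transitivity (\det N).
  by apply: eq_bigr => s _; congr (_ * _); apply: eq_bigr => i _; rewrite mxE.
rewrite (expand_det_row _ k); apply: eq_bigr => j _; rewrite mxE eqxx.
congr (_ * (_ * \det _)); apply/matrixP => a b; rewrite !mxE.
by rewrite eq_sym (negPf (neq_lift _ _)).
Qed.

(** Bare existence is enough: it only serves to make the inverse matrix differentiable, and the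
    value of that derivative is found in another way. *)
Lemma drv_cofactor_ex n (M : T -> 'M[C]_n) (L : 'M[C]_n) i j :
  (forall i j, H (fun x => M x i j) (L i j)) ->
  exists l, H (fun x => cofactor (M x) i j) l.
Proof.
move=> ML; eexists; apply: drvZ; apply: drv_det (row' i (col' j L)) _ => a b.
by rewrite !mxE; apply: (drv_eq HD _ (ML (lift i a) (lift j b))) => x _; rewrite !mxE.
Qed.

(** Cramer's rule shows that the entries of the inverse are differentiable; uniqueness of
    derivatives applied to M M^-1 = 1 then determines the values. *)
Lemma drv_invmx n (M : T -> 'M[C]_n) (L : 'M[C]_n) :
  (forall x, U x -> M x \in unitmx) ->
  (forall i j, H (fun x => M x i j) (L i j)) ->
  forall i j, H (fun x => invmx (M x) i j)
    ((- (invmx (M p) *m L *m invmx (M p))) i j).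
Proof.
move=> Mu ML.
have inv_ex i j : exists l, H (fun x => invmx (M x) i j) l.
  have [l cl] := drv_cofactor_ex j i ML.
  have dp : \det (M p) != 0 by rewrite -unitfE -[_ \is a _]/(_ \in unitmx) Mu.
  eexists; apply: (drv_eq HD _ (drvM HD (drvV HD dp (drv_det ML)) cl)) => x Ux.
  by rewrite /invmx Mu // !mxE.
have [l' /= ll'] := choice (fun ij : 'I_n * 'I_n => inv_ex ij.1 ij.2).
pose L' := \matrix_(i, j) l' (i, j).
have ML' i j : H (fun x => invmx (M x) i j) (L' i j).
  by rewrite mxE; exact: (ll' (i, j)).
suff -> : - (invmx (M p) *m L *m invmx (M p)) = L' by [].
have : L *m invmx (M p) + M p *m L' = 0.
  apply/matrixP => i k; rewrite !mxE -big_split /=.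
  under eq_bigr do rewrite [L' _ _]mxE.
  apply: (drv_uniq HD (f := fun x => \sum_j M x i j * invmx (M x) j k)).
    by apply: drv_sum => j; exact: (drvM HD (ML i j) (ll' (j, k))).
  apply: (drv_eq HD _ (drv_cst HD ((1%:M : 'M[C]_n) i k))) => x Ux.
  by rewrite -(mulmxV (Mu x Ux)) mxE.
move=> /eqP; rewrite addrC addr_eq0 => /eqP e.
by rewrite -mulmxA -mulmxN -e mulKmx // Mu.
Qed.

(** Dividing Jacobi's formula by the determinant turns cofactors into entries of the inverse, which
    gives the trace of M^-1 L. *)
Lemma drv_ln_det n (M : T -> 'M[C]_n) (L : 'M[C]_n) :
  (forall x, U x -> 0 < \det (M x)) ->
  (forall i j, H (fun x => M x i j) (L i j)) ->
  H (fun x => (ln (complex.Re (\det (M x))))%:C)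
    (\sum_i \sum_j invmx (M p) j i * L i j).
Proof.
move=> Mpos ML; have := drv_ln HD Mpos (drv_det ML); congr H.
have dp : \det (M p) != 0 by rewrite gt_eqF // Mpos.
rewrite mulr_suml; apply: eq_bigr => i _; rewrite mulr_suml; apply: eq_bigr => j _.
by rewrite /invmx unitmxE unitfE dp !mxE; ring.
Qed.

End DerivationTheory.

(** * The lift of d/ds and the function c *)

Lemma big_option (V : nmodType) (I : finType) (F : option I -> V) :
  \sum_a F a = F None + \sum_i F (Some i).
Proof.
rewrite (bigD1 None) //=; congr (_ + _).
rewrite (reindex_omap Some id) /=; last by case.
by apply: eq_bigl => i; rewrite eqxx.
Qed.

Section Schur.
Context {R : realType} {n : nat}.
Local Notation C := R[i].
Local Notation ix := (option 'I_n).
Implicit Type G : ix -> ix -> C.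

Definition fib G : 'M[C]_n := \matrix_(i, j) G (Some i) (Some j).

(* Coefficients of the lift W = d/ds - V and of its conjugate; [None] is the index
   of the base coordinate s. *)
Definition liftl G (a : ix) : C :=
  if a is Some i then - \sum_j invmx (fib G) j i * G None (Some j) else 1.
Definition liftr G (b : ix) : C :=
  if b is Some j then - \sum_i invmx (fib G) j i * G (Some i) None else 1.

(** The Schur complement of the fiber block in the matrix indexed by s and the z_i. For the matrix
    f_{a bbar} it is c(f). *)
Definition schur G : C :=
  G None None
  - \sum_i \sum_j invmx (fib G) j i * G None (Some j) * G (Some i) None.

(** This is the linear system defining V, read as the orthogonality of W to the fibers. *)
Lemma liftl_orth G j : fib G \in unitmx ->
  \sum_a liftl G a * G a (Some j) = 0.
Proof.
move=> Gu; rewrite big_option /= mul1r.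
under eq_bigr do rewrite mulNr mulr_suml.
rewrite sumrN exchange_big /=; apply/eqP; rewrite subr_eq0; apply/eqP.
have := mulVmx Gu => /matrixP E.
transitivity (\sum_k G None (Some k) * (1%:M : 'M[C]_n) k j).
  rewrite (bigD1 j) //= mxE eqxx mulr1 big1 ?addr0 // => k kj.
  by rewrite mxE (negPf kj) mulr0.
apply: eq_bigr => k _; rewrite -E mxE mulr_sumr; apply: eq_bigr => i _.
by rewrite [fib G _ _]mxE; ring.
Qed.

Lemma liftr_orth G i : fib G \in unitmx ->
  \sum_b liftr G b * G (Some i) b = 0.
Proof.
move=> Gu; rewrite big_option /= mul1r.
under eq_bigr do rewrite mulNr mulr_suml.
rewrite sumrN exchange_big /=; apply/eqP; rewrite subr_eq0; apply/eqP.
have := mulmxV Gu => /matrixP E.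
transitivity (\sum_k (1%:M : 'M[C]_n) i k * G (Some k) None).
  rewrite (bigD1 i) //= mxE eqxx mul1r big1 ?addr0 // => k ki.
  by rewrite mxE eq_sym (negPf ki) mul0r.
apply: eq_bigr => k _; rewrite -E mxE mulr_suml; apply: eq_bigr => j _.
by rewrite [fib G _ _]mxE; ring.
Qed.

(** By orthogonality the terms with a vertical index [b] vanish, and [liftr G None] is 1. *)
Lemma schurE G : fib G \in unitmx ->
  schur G = \sum_a \sum_b liftl G a * liftr G b * G a b.
Proof.
move=> Gu; rewrite exchange_big big_option /= [X in _ + X]big1 ?addr0 => [|j _].
  rewrite big_option /= !mul1r; congr (_ + _); rewrite -sumrN.
  by apply: eq_bigr => i _; rewrite mulr1 mulNr mulr_suml.
under eq_bigr do rewrite mulrAC.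
by rewrite -mulr_suml liftl_orth // mul0r.
Qed.

Section SchurDerivation.
Context (T : Type) (U : set T) (p : T) (H : (T -> C) -> C -> Prop).
Hypotheses (Up : U p) (HD : is_derivation U p H).
Context (G : T -> ix -> ix -> C) (dG : ix -> ix -> C).
Hypotheses (Gu : forall x, U x -> fib (G x) \in unitmx)
  (HG : forall a b, H (fun x => G x a b) (dG a b)).

Let H_inv i j : H (fun x => invmx (fib (G x)) i j)
  ((- (invmx (fib (G p)) *m fib dG *m invmx (fib (G p)))) i j).
Proof.
apply: (drv_invmx Up HD Gu) => {}i {}j; rewrite mxE.
by apply: (drv_eq HD _ (HG _ _)) => x _; rewrite mxE.
Qed.

(** The explicit derivative of the lift stays hidden. What matters later is the linear relation
    obtained by differentiating the orthogonality, which trades derivatives of W for third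
    derivatives of the weight. *)
Lemma drv_liftl : exists dl : ix -> C,
  [/\ dl None = 0, forall a, H (fun x => liftl (G x) a) (dl a) &
    forall j, \sum_a liftl (G p) a * dG a (Some j)
      + \sum_i dl (Some i) * G p (Some i) (Some j) = 0].
Proof.
pose dl a := if a is Some i then - \sum_j
    ((- (invmx (fib (G p)) *m fib dG *m invmx (fib (G p)))) j i
       * G p None (Some j) + invmx (fib (G p)) j i * dG None (Some j)) else 0 : C.
have Hdl a : H (fun x => liftl (G x) a) (dl a).
  case: a => [i|] /=; last exact: drv_cst HD 1.
  by apply: (drvN HD); apply: (drv_sum HD) => j; exact: (drvM HD (H_inv j i) (HG _ _)).
exists dl; split=> // j.
have : H (fun x => \sum_a liftl (G x) a * G x a (Some j)) 0.
  by apply: (drv_eq HD _ (drv_cst HD 0)) => x Ux; rewrite liftl_orth // Gu.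
move=> /(drv_uniq HD (drv_sum HD _ (fun a => drvM HD (Hdl a) (HG a (Some j))))).
by rewrite big_split /= [X in X + _]big_option /= mul0r add0r addrC.
Qed.

Lemma drv_liftr : exists dr : ix -> C,
  [/\ dr None = 0, forall b, H (fun x => liftr (G x) b) (dr b) &
    forall i, \sum_b liftr (G p) b * dG (Some i) b
      + \sum_j dr (Some j) * G p (Some i) (Some j) = 0].
Proof.
pose dr b := if b is Some j then - \sum_i
    ((- (invmx (fib (G p)) *m fib dG *m invmx (fib (G p)))) j i
       * G p (Some i) None + invmx (fib (G p)) j i * dG (Some i) None) else 0 : C.
have Hdr b : H (fun x => liftr (G x) b) (dr b).
  case: b => [j|] /=; last exact: drv_cst HD 1.
  by apply: (drvN HD); apply: (drv_sum HD) => i; exact: (drvM HD (H_inv j i) (HG _ _)).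
exists dr; split=> // i.
have : H (fun x => \sum_b liftr (G x) b * G x (Some i) b) 0.
  by apply: (drv_eq HD _ (drv_cst HD 0)) => x Ux; rewrite liftr_orth // Gu.
move=> /(drv_uniq HD (drv_sum HD _ (fun b => drvM HD (Hdr b) (HG (Some i) b)))).
by rewrite big_split /= [X in X + _]big_option /= mul0r add0r addrC.
Qed.

(* The lift enters the Schur complement through two orthogonality relations, so
   its own derivatives cancel. *)
Lemma drv_schur :
  H (fun x => schur (G x))
    (\sum_a \sum_b liftl (G p) a * liftr (G p) b * dG a b).
Proof.
have [dl [dl0 Hdl _]] := drv_liftl.
have [dr [dr0 Hdr _]] := drv_liftr.
have := drv_sum HD (index_enum ix) (fun a => drv_sum HD (index_enum ix)
  (fun b => drvM HD (drvM HD (Hdl a) (Hdr b)) (HG a b))).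
move=> K; have {K} := drv_eq HD (fun x Ux => esym (schurE (Gu Ux))) K.
congr H.
under eq_bigr do (under eq_bigr do rewrite mulrDl -addrA; rewrite big_split).
rewrite big_split /= [X in X + _](_ : _ = 0) ?add0r.
  under eq_bigr do rewrite big_split.
  rewrite big_split /= [X in X + _](_ : _ = 0) ?add0r //.
  rewrite exchange_big big_option /= dr0 [X in X + _]big1 ?add0r => [|a _].
    rewrite big1 // => j _; under eq_bigr do rewrite mulrAC.
    by rewrite -mulr_suml liftl_orth ?mul0r // Gu.
  by rewrite mulr0 mul0r.
rewrite big_option /= [X in X + _]big1 ?add0r => [|b _]; last by rewrite dl0 !mul0r.
rewrite big1 // => i _; under eq_bigr do rewrite -mulrA.
by rewrite -mulr_sumr liftr_orth ?mulr0 // Gu.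
Qed.

End SchurDerivation.
End Schur.

(** * The algebraic identity between the second derivatives of c and of log det *)

Section CurvatureIdentity.
Context {K : comUnitRingType} {n : nat}.
Local Notation ix := (option 'I_n).

(** Here [wl], [wr] stand for W and its conjugate at a point, [dl], [dr] for their derivatives d_k,
    and [dbl], [dbr] for their derivatives dbar_l. The left side is Delta c + |A|^2, the right side
    the form d_a dbar_b log det evaluated on W. *)
Lemma curvature_identity (wl wr : ix -> K) (G : 'M[K]_n)
    (dG dbG : ix -> ix -> ix -> K) (ddG : ix -> ix -> ix -> ix -> K)
    (dl dbl dr dbr : 'I_n -> ix -> K) :
  G \in unitmx ->
  (forall k, dl k None = 0) -> (forall k, dr k None = 0) ->
  (forall k j, \sum_a wl a * dG (Some k) a (Some j)
     + \sum_i dl k (Some i) * G i j = 0) ->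
  (forall l j, \sum_a wl a * dbG (Some l) a (Some j)
     + \sum_i dbl l (Some i) * G i j = 0) ->
  (forall l i, \sum_b wr b * dbG (Some l) (Some i) b
     + \sum_j dbr l (Some j) * G i j = 0) ->
  (forall k a b, dG k a b = dG a k b) ->
  (forall l a b, dbG l a b = dbG b a l) ->
  (forall k l a b, ddG k l a b = ddG a b k l) ->
  \sum_k \sum_l invmx G l k *
     \sum_a \sum_b ((dl k a * wr b + wl a * dr k b) * dbG (Some l) a b
                    + wl a * wr b * ddG (Some k) (Some l) a b)
  + \sum_i \sum_j \sum_k \sum_l
      G i k * invmx G j l * dbl j (Some i) * dr l (Some k)
  = \sum_a \sum_b wl a * wr b * \sum_i \sum_j
      ((- (invmx G *m (\matrix_(k, l) dG a (Some k) (Some l)) *m invmx G)) j i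
          * dbG b (Some i) (Some j)
       + invmx G j i * ddG a b (Some i) (Some j)).
Proof.
move=> Gu dl0 dr0 R1 R2 R3 sG sbG sdd.
(* Third derivatives contracted with W and its conjugate: both sides will contain the same trace in
   [X] and [Y]. *)
pose X := \matrix_(k, j) \sum_a wl a * dG a (Some k) (Some j).
pose Y := \matrix_(i, l) \sum_b wr b * dbG b (Some i) (Some l).
pose L := \matrix_(k, i) dl k (Some i).
pose Lb := \matrix_(i, l) dbr l (Some i).
have XE : X = - (L *m G).
  apply/matrixP => k j; rewrite !mxE.
  under eq_bigr do rewrite -sG.
  have := R1 k j; move=> /eqP; rewrite addr_eq0 => /eqP ->.
  by congr (- _); apply: eq_bigr => i _; rewrite mxE.
have YE : Y = - (G *m Lb).
  apply/matrixP => i l; rewrite !mxE.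
  under eq_bigr do rewrite sbG.
  have := R3 l i; move=> /eqP; rewrite addr_eq0 => /eqP ->.
  by congr (- _); apply: eq_bigr => j _; rewrite mxE mulrC.
(* The derivatives d_k W give L Y, and L = - X G^-1. This is the term that the derivative of the
   inverse matrix produces on the right. *)
have first_term k l : \sum_a \sum_b (dl k a * wr b) * dbG (Some l) a b
    = - (X *m invmx G *m Y) k l.
  have -> : X *m invmx G *m Y = - (L *m Y).
    by rewrite XE mulNmx mulmxK // mulNmx.
  rewrite mxE opprK mxE big_option /= [X in X + _]big1 ?add0r => [|b _].
    apply: eq_bigr => i _; rewrite !mxE mulr_sumr; apply: eq_bigr => b _.
    by rewrite sbG mulrA.
  by rewrite dl0 !mul0r.
(* The derivatives d_k of the conjugate lift meet a third derivative contracted with W, which [R2]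
   expresses by dbar_l W. Traced, this is -|A|^2. *)
have second_term k l : \sum_a \sum_b (wl a * dr k b) * dbG (Some l) a b
    = - \sum_i \sum_j G i j * dbl l (Some i) * dr k (Some j).
  rewrite exchange_big big_option /= [X in X + _]big1 ?add0r => [|a _].
    rewrite [in RHS]exchange_big -sumrN; apply: eq_bigr => j _ /=.
    under eq_bigr do rewrite mulrAC.
    rewrite -mulr_suml; have := R2 l j => /eqP; rewrite addr_eq0 => /eqP ->.
    by rewrite mulNr mulr_suml; congr (- _); apply: eq_bigr => i _; rewrite [G _ _ * _]mulrC.
  by rewrite dr0 mulr0 mul0r.
have lhs k l :
  \sum_a \sum_b ((dl k a * wr b + wl a * dr k b) * dbG (Some l) a b
                    + wl a * wr b * ddG (Some k) (Some l) a b)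
  = - (X *m invmx G *m Y) k l
    - \sum_i \sum_j G i j * dbl l (Some i) * dr k (Some j)
    + \sum_a \sum_b wl a * wr b * ddG (Some k) (Some l) a b.
  rewrite -first_term -second_term -!big_split /=; apply: eq_bigr => a _.
  by rewrite -!big_split /=; apply: eq_bigr => b _; rewrite mulrDl.
under eq_bigr do under eq_bigr do rewrite lhs mulrDr mulrBr.
under eq_bigr do rewrite big_split sumrB.
rewrite big_split sumrB /=.
(* The traced second term cancels the added |A|^2; the rest of this block reorders the four
   summations. *)
rewrite addrAC -[X in X + _]addrA [X in (_ + X) + _](_ : _ = 0) ?addr0; last first.
  apply/eqP; rewrite addrC subr_eq0; apply/eqP.
  rewrite (eq_bigr (fun i => \sum_k \sum_j \sum_l
    G i k * invmx G j l * dbl j (Some i) * dr l (Some k))); last first.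
    by move=> i _; rewrite exchange_big.
  under eq_bigr do under eq_bigr do rewrite exchange_big.
  under eq_bigr do rewrite exchange_big; rewrite exchange_big.
  apply: eq_bigr => k _ /=.
  under eq_bigr do rewrite exchange_big; rewrite exchange_big.
  apply: eq_bigr => l _ /=.
  rewrite mulr_sumr; apply: eq_bigr => i _; rewrite mulr_sumr; apply: eq_bigr => j _.
  by ring.
have rhs a b : wl a * wr b * (\sum_i \sum_j
      ((- (invmx G *m (\matrix_(k, l) dG a (Some k) (Some l)) *m invmx G)) j i
          * dbG b (Some i) (Some j)
       + invmx G j i * ddG a b (Some i) (Some j)))
  = \sum_i \sum_j (- (invmx G *m (wl a *: \matrix_(k, l) dG a (Some k) (Some l))
           *m invmx G)) j i * (wr b * dbG b (Some i) (Some j))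
    + \sum_i \sum_j invmx G j i * (wl a * wr b * ddG (Some i) (Some j) a b).
  rewrite -big_split mulr_sumr; apply: eq_bigr => i _.
  rewrite -big_split mulr_sumr; apply: eq_bigr => j _ /=.
  rewrite -scalemxAr -scalemxAl.
  move: (_ *m _ *m _) => P; rewrite [in RHS]mxE [in RHS]mxE [in LHS]mxE sdd; ring.
under [RHS]eq_bigr do under eq_bigr do rewrite rhs.
under [RHS]eq_bigr do rewrite big_split.
(* Fourth derivatives are compared with fourth derivatives, already matched by [sdd]; the quadratic
   terms in third derivatives remain. *)
rewrite [RHS]big_split /=; congr (_ + _); last first.
  under eq_bigr do under eq_bigr do rewrite mulr_sumr.
  under eq_bigr do rewrite exchange_big; rewrite exchange_big /=.
  apply: eq_bigr => a _.
  under eq_bigr do under eq_bigr do rewrite mulr_sumr.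
  under eq_bigr do rewrite exchange_big; rewrite exchange_big /=.
  by apply: eq_bigr => b _.
(* Both quadratic terms are this trace; on the right it appears after expanding [X] as a sum over
   [a]. *)
transitivity (- \tr (invmx G *m X *m invmx G *m Y)).
  rewrite -2!mulmxA mulmxA /mxtrace exchange_big -sumrN; apply: eq_bigr => l _ /=.
  rewrite -2!mulmxA mulmxA mxE -sumrN; apply: eq_bigr => k _.
  by rewrite mulrN.
have -> : X = \sum_a wl a *: \matrix_(k, l) dG a (Some k) (Some l).
  by apply/matrixP => k j; rewrite mxE summxE; apply: eq_bigr => a _; rewrite !mxE.
rewrite mulmx_sumr mulmx_suml mulmx_suml [\tr _]raddf_sum /= -sumrN.
apply: eq_bigr => a _; rewrite /mxtrace -sumrN.
under [RHS]eq_bigr do rewrite exchange_big.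
rewrite [RHS]exchange_big /=; apply: eq_bigr => j _.
rewrite mxE [RHS]exchange_big -sumrN; apply: eq_bigr => i _ /=.
rewrite -mulr_sumr [Y _ _]mxE; move: (_ *m _) => Z.
by rewrite mxE mulNr.
Qed.

End CurvatureIdentity.

(** * Positive definite Hermitian matrices *)

Section PositiveHermitian.
Context {R : realType} {n : nat}.
Local Notation C := R[i].

(** By the spectral theorem the determinant is the product of the eigenvalues, and each eigenvalue
    is the value of the form on a row of a unitary matrix. *)
Lemma posdef_det_gt0 (H : 'M[C]_n) :
  (forall i j, (H i j)^* = H j i) -> posdef H -> 0 < \det H.
Proof.
move=> Hh Hpos.
have Hherm : H \is hermsymmx.
  apply/is_hermitianmxP; rewrite expr0 scale1r; apply/matrixP => i j.
  by rewrite !mxE; exact: esym (Hh _ _).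
set P := spectralmx H; pose sp := spectral_diag H.
have HE : H = invmx P *m diag_mx sp *m P.
  exact/orthomx_spectralP/hermitian_normalmx.
have Pu : P \in unitmx by exact: spectral_unit.
have Punit : P \is unitarymx by exact: spectral_unitarymx.
have spE i : sp 0 i = \sum_k \sum_l H k l * P i k * (P i l)^*.
  have : (P *m H *m invmx P) i i = sp 0 i.
    rewrite HE !mulmxA mulmxV // mul1mx -mulmxA mulmxV // mulmx1.
    by rewrite mxE eqxx.
  move=> <-; rewrite invmx_unitary // mxE exchange_big.
  apply: eq_bigr => l _ /=; rewrite mxE mulr_suml !mxE; apply: eq_bigr => k _.
  by rewrite [P i k * _]mulrC.
have -> : \det H = \prod_i sp 0 i.
  rewrite HE !det_mulmx mulrAC -det_mulmx mulVmx // det1 mul1r det_diag.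
  by [].
apply: prodr_gt0 => i _; rewrite spE.
have := Hpos (row i P); under eq_bigr do under eq_bigr do rewrite !mxE.
apply; apply/eqP => Pi0.
(* A zero row of [P] would make a diagonal entry of [P *m Q = 1] vanish. *)
have := row_free_unit P; rewrite Pu => /row_freeP[Q PQ].
have := congr1 (fun M : 'M[C]_n => row i M) PQ.
rewrite row_mul Pi0 mul0mx => /rowP/(_ i)/eqP; rewrite !mxE eqxx eq_sym.
by rewrite oner_eq0.
Qed.

Lemma conj_invmx (H : 'M[C]_n) i j :
  (forall i j, (H i j)^* = H j i) -> (invmx H i j)^* = invmx H j i.
Proof.
move=> Hh; have E : map_mx Num.conj H = H^T.
  by apply/matrixP => k l; rewrite !mxE; exact: Hh.
transitivity (map_mx Num.conj (invmx H) i j); first by rewrite mxE.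
by rewrite map_invmx E -trmx_inv mxE.
Qed.

End PositiveHermitian.

(** * Commuting partial derivatives *)

Section WithinDerivative.
Context {R : realType}.
Local Notation C := R[i].
Implicit Types (J : set R).

Definition accum J := forall r : R, 0 < r -> exists x, [/\ J x, x != 0 & `|x| < r].

#[global] Instance near_time_filter J t : Filter (near_time J t).
Proof. exact: within_filter. Qed.

(** A nondegenerate interval leaves room on at least one side of each of its points: towards [t1] if
    [t < t1], otherwise towards [t0]. Thus limits within it are unique. *)
Lemma near_time_proper J t :
  is_interval J -> (exists t0 t1, [/\ J t0, J t1 & t0 < t1]) -> J t ->
  ProperFilter (near_time J t).
Proof.
move=> Ji [t0 [t1 [J0 J1 t01]]] Jt; apply: Build_ProperFilter_ex => P.
rewrite /near_time /within /= => /nbhs_ballP[d /= d0 dP].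
have [tt1|t1t] := ltP t t1.
  have h0 : 0 < Num.min (d / 2) (t1 - t) by rewrite lt_min divr_gt0 //= subr_gt0.
  exists (Num.min (d / 2) (t1 - t)); apply: dP => /=.
  - rewrite /ball /= sub0r normrN gtr0_norm // gt_min; apply/orP; left; lra.
  - by rewrite gt_eqF.
  - apply: (Ji t t1) => //; rewrite lerDl ltW //=.
    by rewrite -lerBrDl ge_min lexx orbT.
have h0 : 0 < Num.min (d / 2) (t - t0).
  by rewrite lt_min divr_gt0 //= subr_gt0 (lt_le_trans t01).
exists (- Num.min (d / 2) (t - t0)); apply: dP => /=.
- rewrite /ball /= sub0r opprK gtr0_norm // gt_min; apply/orP; left; lra.
- by rewrite oppr_eq0 gt_eqF.
- apply: (Ji t0 t) => //; rewrite gerDl oppr_le0 (ltW h0) andbT.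
  by rewrite lerBrDl -lerBrDr ge_min lexx orbT.
Qed.

Definition has_rderive J (g : R -> R) x (l : R) :=
  (fun h => (g (x + h) - g x) / h) @ near_time J x --> l.

Lemma has_tderive_Re J (g : R -> C) x l : has_tderive J g x l ->
  has_rderive J (fun x => complex.Re (g x)) x (complex.Re l).
Proof.
move=> /cvg_Re; rewrite /has_rderive; apply: cvg_trans; apply: near_eq_cvg.
apply: nearW => h; rewrite /tquot -fmorphV /= mulrC.
by case: (g (x + h)) (g x) => [a b] [c d] /=; rewrite mul0r subr0 mulrC.
Qed.

Lemma has_tderive_Im J (g : R -> C) x l : has_tderive J g x l ->
  has_rderive J (fun x => complex.Im (g x)) x (complex.Im l).
Proof.
move=> /cvg_Im; rewrite /has_rderive; apply: cvg_trans; apply: near_eq_cvg.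
apply: nearW => h; rewrite /tquot -fmorphV /= mulrC.
by case: (g (x + h)) (g x) => [a b] [c d] /=; rewrite mul0r addr0 mulrC.
Qed.

Lemma has_rderiveB J f g x l m : has_rderive J f x l -> has_rderive J g x m ->
  has_rderive J (fun x => f x - g x) x (l - m).
Proof.
move=> fl gm; rewrite /has_rderive.
rewrite (_ : (fun _ => _) = fun h => (f (x + h) - f x) / h - (g (x + h) - g x) / h).
  exact: cvgB fl gm.
by apply/funext => h; rewrite -mulrBl; congr (_ / _); ring.
Qed.

Lemma has_rderive_cont J g x l : has_rderive J g x l ->
  forall e, 0 < e -> exists2 d, 0 < d &
    forall y, J y -> `|x - y| < d -> `|g x - g y| < e.
Proof.
move=> gl e e0.
have Jx0 : (fun h : R => h) @ near_time J x --> (0 : R).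
  by apply: cvg_within_filter; apply: cvg_within_filter; exact: cvg_id.
have : (fun h => (g (x + h) - g x) / h * h) @ near_time J x --> (l * 0 : R).
  exact: cvgM gl Jx0.
rewrite mulr0 => /cvgrPdist_lt /(_ e e0).
rewrite /near_time ?near_simpl /within /= => /nbhs_ballP[d /= d0 dP].
exists d => // y Jy xy.
have [->|ne] := eqVneq y x; first by rewrite subrr normr0.
have := dP (y - x); rewrite /ball /= sub0r normrN distrC => /(_ xy).
rewrite subr_eq0 => /(_ ne); rewrite [x + _]addrC subrK => /(_ Jy).
by rewrite sub0r normrN divfK ?subr_eq0 // distrC.
Qed.

(** The derivatives within [J] give continuity up to the end points of [a, b]. Inside, [J] contains
    a neighborhood of the point, so they are ordinary derivatives. *)
Lemma mvt_within_lt J (g g' : R -> R) a b : is_interval J -> J a -> J b -> a < b ->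
  (forall x, J x -> has_rderive J g x (g' x)) ->
  exists c, [/\ J c, a <= c <= b & g b - g a = g' c * (b - a)].
Proof.
move=> Ji Ja Jb ab gg'.
have Jab x : a <= x <= b -> J x by exact: Ji.
have [||c] := @MVT R g g' a b ab; last first.
- rewrite in_itv /= => /andP[ac cb] E; exists c.
  by rewrite !ltW //; split => //; apply: Jab; rewrite !ltW.
- apply/subspace_continuousP => x /=; rewrite in_itv /= => xab.
  apply/cvgrPdist_lt => e e0.
  have [d d0 dP] := has_rderive_cont (gg' x (Jab x xab)) e0.
  rewrite ?near_simpl /within /=; apply/nbhs_ballP; exists d => //= y.
  by rewrite /ball /= in_itv /= => xy yab; apply: dP => //; exact: Jab.
move=> x; rewrite in_itv /= => /andP[ax xb].
have Jx : J x by apply: Jab; rewrite !ltW.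
have nJ : \forall h \near (0 : R)^', J (x + h).
  apply: cvg_within; apply/nbhs_ballP.
  exists (Num.min (x - a) (b - x)) => /=; first by rewrite lt_min !subr_gt0 ax.
  move=> h; rewrite /ball /= sub0r normrN lt_min !ltr_norml => /andP[/andP[? ?] /andP[? ?]].
  apply: Jab; apply/andP; split; lra.
have glim : (fun h => h^-1 *: (g (h *: 1 + x) - g x)) @ (0 : R)^' --> g' x.
  apply: cvg_trans; last exact: gg' x Jx.
  move=> P; rewrite /near_time ?near_simpl /within /= => H.
  apply: filterS2 nJ H => h Jh /(_ Jh).
  by rewrite /GRing.scale /= mulr1 mulrC [h + x]addrC.
apply: DeriveDef; first by apply/cvg_ex; exists (g' x).
by rewrite /derive; apply: cvg_lim.
Qed.

End WithinDerivative.

Section Schwarz.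
Context {R : realType}.
Local Notation C := R[i].
Implicit Types (J : set R).

Lemma mvt_within J (g g' : R -> R) b : is_interval J -> J 0 -> J b -> b != 0 ->
  (forall x, J x -> has_rderive J g x (g' x)) ->
  exists c, [/\ J c, `|c| <= `|b| & g b - g 0 = g' c * b].
Proof.
move=> Ji J0 Jb; rewrite neq_lt => /orP[b0|b0] gg'.
  have [c [Jc /andP[bc c0] E]] := mvt_within_lt Ji Jb J0 b0 gg'.
  exists c; split => //; first by rewrite !ler0_norm ?(ltW b0) // lerN2.
  by rewrite -opprB E; ring.
have [c [Jc /andP[c0 cb] E]] := mvt_within_lt Ji J0 Jb b0 gg'.
by exists c; split => //; [rewrite !ger0_norm ?(ltW b0) | rewrite E subr0].
Qed.

(* Both mixed derivatives are values of the same second difference quotient. *)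
Lemma real_schwarz (J1 J2 : set R) (g g1 g2 g12 g21 : R -> R -> R) :
  is_interval J1 -> is_interval J2 -> accum J1 -> accum J2 -> J1 0 -> J2 0 ->
  (forall x y, J1 x -> J2 y -> has_rderive J1 (g^~ y) x (g1 x y)) ->
  (forall x y, J1 x -> J2 y -> has_rderive J2 (g x) y (g2 x y)) ->
  (forall x y, J1 x -> J2 y -> has_rderive J2 (g1 x) y (g12 x y)) ->
  (forall x y, J1 x -> J2 y -> has_rderive J1 (g2^~ y) x (g21 x y)) ->
  (forall e, 0 < e -> exists2 r, 0 < r & forall x y, J1 x -> J2 y ->
     `|x| < r -> `|y| < r -> `|g12 0 0 - g12 x y| < e) ->
  (forall e, 0 < e -> exists2 r, 0 < r & forall x y, J1 x -> J2 y ->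
     `|x| < r -> `|y| < r -> `|g21 0 0 - g21 x y| < e) ->
  g12 0 0 = g21 0 0.
Proof.
move=> i1 i2 a1 a2 J10 J20 h1 h2 h12 h21 c12 c21.
apply/eqP; rewrite -subr_eq0 -normr_le0; apply/ler_addgt0Pl => e e0.
rewrite addr0.
have e20 : 0 < e / 2 by rewrite divr_gt0.
have [r r0 c12e] := c12 _ e20; have [r' r'0 c21e] := c21 _ e20.
have m0 : 0 < Num.min r r' by rewrite lt_min r0.
have [x [Jx x0 xr]] := a1 _ m0; have [y [Jy y0 yr]] := a2 _ m0.
(* The second difference over the rectangle with opposite corners (0, 0) and (x, y), treated by the
   mean value theorem in x and then in y; below, in the other order. *)
have [c [Jc cx E1]] : exists c, [/\ J1 c, `|c| <= `|x| &
    (g x y - g x 0) - (g 0 y - g 0 0) = (g1 c y - g1 c 0) * x].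
  apply: (mvt_within (g := fun x => g x y - g x 0)
    (g' := fun x => g1 x y - g1 x 0) i1 J10 Jx x0) => z Jz.
  by apply: has_rderiveB; exact: h1.
have [d [Jd dy E2]] : exists d, [/\ J2 d, `|d| <= `|y| &
    g1 c y - g1 c 0 = g12 c d * y].
  exact: (mvt_within (g := g1 c) (g' := g12 c) i2 J20 Jy y0 (fun z => @h12 c z Jc)).
have [d' [Jd' dy' E3]] : exists d, [/\ J2 d, `|d| <= `|y| &
    (g x y - g 0 y) - (g x 0 - g 0 0) = (g2 x d - g2 0 d) * y].
  apply: (mvt_within (g := fun y => g x y - g 0 y)
    (g' := fun y => g2 x y - g2 0 y) i2 J20 Jy y0) => z Jz.
  by apply: has_rderiveB; exact: h2.
have [c' [Jc' cx' E4]] : exists c, [/\ J1 c, `|c| <= `|x| &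
    g2 x d' - g2 0 d' = g21 c d' * x].
  exact: (mvt_within (g := g2^~ d') (g' := g21^~ d') i1 J10 Jx x0
    (fun z Jz => @h21 z d' Jz Jd')).
have E : g12 c d = g21 c' d'.
  apply: (mulIf (mulf_neq0 x0 y0)).
  have -> : g12 c d * (x * y) = (g12 c d * y) * x by ring.
  have -> : g21 c' d' * (x * y) = (g21 c' d' * x) * y by ring.
  by rewrite -E2 -E1 -E4 -E3; ring.
move: xr yr; rewrite !lt_min => /andP[xr xr'] /andP[yr yr'].
have A1 := c12e _ _ Jc Jd (le_lt_trans cx xr) (le_lt_trans dy yr).
have A2 := c21e _ _ Jc' Jd' (le_lt_trans cx' xr') (le_lt_trans dy' yr').
have -> : g12 0 0 - g21 0 0 = (g12 0 0 - g12 c d) - (g21 0 0 - g21 c' d').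
  by rewrite E; ring.
apply: (le_trans (ler_normB _ _)); rewrite (splitr e).
by apply: lerD; exact: ltW.
Qed.

(** The mean value theorem fails for complex values, so the real and imaginary parts are treated
    separately. *)
Lemma complex_schwarz (J1 J2 : set R) (g g1 g2 g12 g21 : R -> R -> C) :
  is_interval J1 -> is_interval J2 -> accum J1 -> accum J2 -> J1 0 -> J2 0 ->
  (forall x y, J1 x -> J2 y -> has_tderive J1 (g^~ y) x (g1 x y)) ->
  (forall x y, J1 x -> J2 y -> has_tderive J2 (g x) y (g2 x y)) ->
  (forall x y, J1 x -> J2 y -> has_tderive J2 (g1 x) y (g12 x y)) ->
  (forall x y, J1 x -> J2 y -> has_tderive J1 (g2^~ y) x (g21 x y)) ->
  (forall e : R, 0 < e -> exists2 r : R, 0 < r & forall x y, J1 x -> J2 y ->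
     `|x| < r -> `|y| < r -> `|g12 0 0 - g12 x y| < e%:C) ->
  (forall e : R, 0 < e -> exists2 r : R, 0 < r & forall x y, J1 x -> J2 y ->
     `|x| < r -> `|y| < r -> `|g21 0 0 - g21 x y| < e%:C) ->
  g12 0 0 = g21 0 0.
Proof.
move=> i1 i2 a1 a2 J10 J20 h1 h2 h12 h21 c12 c21.
have reim (f : C -> R) :
    (forall J (g : R -> C) x l, has_tderive J g x l ->
       has_rderive J (fun x => f (g x)) x (f l)) ->
    (forall z w, `|f z - f w|%:C <= `|z - w|) ->
    f (g12 0 0) = f (g21 0 0).
  move=> fd fn.
  have fc (k : R -> R -> C) :
      (forall e : R, 0 < e -> exists2 r : R, 0 < r & forall x y, J1 x -> J2 y ->
        `|x| < r -> `|y| < r -> `|k 0 0 - k x y| < e%:C) ->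
      (forall e : R, 0 < e -> exists2 r : R, 0 < r & forall x y, J1 x -> J2 y ->
        `|x| < r -> `|y| < r -> `|f (k 0 0) - f (k x y)| < e).
    move=> kc e e0; have [r r0 H] := kc e e0; exists r => // x y Jx Jy xr yr.
    by rewrite -ltcR; apply: le_lt_trans (H x y Jx Jy xr yr); exact: fn.
  apply: (real_schwarz (J1 := J1) (J2 := J2) (g := fun x y => f (g x y))
    (g1 := fun x y => f (g1 x y)) (g2 := fun x y => f (g2 x y))
    (g12 := fun x y => f (g12 x y)) (g21 := fun x y => f (g21 x y))) => //;
    do ?[exact: fc]; move=> x y Jx Jy; apply: fd.
  - exact: h1.
  - exact: h2.
  - exact: h12.
  - exact: h21.
have ReE : complex.Re (g12 0 0) = complex.Re (g21 0 0).
  apply: reim => [J h x l|z w]; first exact: has_tderive_Re.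
  by rewrite -raddfB normc_ge_Re.
have ImE : complex.Im (g12 0 0) = complex.Im (g21 0 0).
  apply: reim => [J h x l|z w]; first exact: has_tderive_Im.
  rewrite -raddfB normc_def lecR -sqrtr_sqr ler_sqrt.
    by rewrite lerDr sqr_ge0.
  by rewrite addr_ge0 // sqr_ge0.
by apply/eqP; rewrite eq_complex ReE ImE !eqxx.
Qed.

End Schwarz.

(** * Smooth families on a time interval times an open set *)

Section JointSmoothness.
Context {R : realType} {n : nat}.
Local Notation C := R[i].
Local Notation E := (model R n).
Implicit Types (f : E -> C) (F G : R -> E -> C) (v p : E) (I : set R) (U : set E).

Definition has_rd v p f (l : C) := rquot v f p h @[h --> 0^'] --> l.

Lemma real_line_cvg p v (T : Type) (F : set_system T) {FF : Filter F} (h : T -> R) (a : R) :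
  h @ F --> a -> (fun x => p + (h x)%:C *: v) @ F --> p + a%:C *: v.
Proof.
move=> ha; apply: cvgD; first exact: cvg_cst.
exact: (cvgZr_tmp (cvg_RtoC ha)).
Qed.

Lemma near_line U p v : open U -> U p ->
  \forall h \near (0 : R), U (p + h%:C *: v).
Proof.
move=> oU Up; have := @real_line_cvg p v R (nbhs (0 : R)) _ id 0 (@cvg_id _ _).
by rewrite scale0r addr0; apply; exact: open_nbhs_nbhs.
Qed.

Lemma rd_derivation U p v : open U -> U p -> is_derivation U p (has_rd v p).
Proof.
move=> oU Up.
apply: (curve_is_derivation (gam := fun h : R => p + h%:C *: v)) => //.
- by apply: cvg_within; exact: near_line.
- exact: cvg_within.
- exact: nbhs_dnbhs_neq.
Qed.

Lemma td_derivation I t : ProperFilter (near_time I t) -> I t ->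
  is_derivation I t (fun g l => has_tderive I g t l).
Proof.
move=> PF It.
apply: (curve_is_derivation (gam := fun h : R => t + h)) => //.
- exact: withinT.
- by apply: cvg_within_filter; exact: cvg_within.
- exact: (@cvg_within _ (0 : R)^' _ [set h | I (t + h)] _ (nbhs_dnbhs_neq (0 : R))).
Qed.

Definition has_jd I (d : option E) F t p (l : C) : Prop :=
  if d is Some v then has_rd v p (F t) l else has_tderive I (F ^~ p) t l.

Definition move_t (d : option E) (t x : R) : R := if d is None then t + x else t.
Definition move_p (d : option E) (p : E) (x : R) : E :=
  if d is Some v then p + x%:C *: v else p.

Section Region.
Context (I : set R) (U : set E).
Hypotheses (Ii : is_interval I) (I01 : exists t0 t1, [/\ I t0, I t1 & t0 < t1])
  (oU : open U).

Lemma jderivableP d F t p :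
  jderivable I d F t p -> has_jd I d F t p (jderive I d F t p).
Proof. by case: d. Qed.

Lemma has_jd_uniq d F t p l l' : I t ->
  has_jd I d F t p l -> has_jd I d F t p l' -> l = l'.
Proof.
move=> It; have PF := near_time_proper Ii I01 It.
case: d => [v|]; exact: (cvg_unique (@norm_hausdorff _ _)).
Qed.

Lemma has_jdE d F t p l : I t ->
  has_jd I d F t p l -> jderivable I d F t p /\ jderive I d F t p = l.
Proof.
move=> It H; have D : jderivable I d F t p by case: d H => [v|] /cvgP.
by split => //; apply: has_jd_uniq (jderivableP D) H.
Qed.

Lemma has_jd_congr d F G t p l : I t -> U p ->
  (forall t p, I t -> U p -> F t p = G t p) ->
  has_jd I d F t p l -> has_jd I d G t p l.
Proof.
move=> It Up FG; case: d => [v|] /=.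
  by apply: (drv_eq (rd_derivation v oU Up)) => q Uq; exact: FG.
apply: (drv_eq (td_derivation (near_time_proper Ii I01 It) It)) => s Is.
exact: FG.
Qed.

Lemma jsmoothP F t p d : jsmooth I U F -> I t -> U p ->
  has_jd I d F t p (jderive I d F t p).
Proof. by move=> /(_ [::])[H _] It Up; apply: jderivableP; exact: H. Qed.

Lemma jsmooth_cont F : jsmooth I U F ->
  {within I `*` U, continuous (fun q : R * E => F q.1 q.2)}.
Proof. by move=> /(_ [::])[]. Qed.

Lemma jsmooth_jderive d F : jsmooth I U F -> jsmooth I U (jderive I d F).
Proof. by move=> sF ds; have := sF (rcons ds d); rewrite foldr_rcons. Qed.

Lemma within_congr F G : (forall t p, I t -> U p -> F t p = G t p) ->
  {within I `*` U, continuous (fun q : R * E => F q.1 q.2)} ->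
  {within I `*` U, continuous (fun q : R * E => G q.1 q.2)}.
Proof.
move=> FG; apply: subspace_eq_continuous => -[t p] /=.
by rewrite inE => -[/= It Up]; exact: FG.
Qed.

(** A class closed under all derivatives consists of smooth families. Closure is asked only up to
    equality on [I] times [U], because rules of calculus identify derivatives only there. *)
Lemma jsmooth_coind (P : (R -> E -> C) -> Prop) :
  (forall F, P F ->
    [/\ forall d t p, I t -> U p -> exists l, has_jd I d F t p l,
        {within I `*` U, continuous (fun q : R * E => F q.1 q.2)} &
        forall d, exists2 G, P G &
          forall t p, I t -> U p -> has_jd I d F t p (G t p)]) ->
  forall F, P F -> jsmooth I U F.
Proof.
move=> HP F PF ds.
suff [G PG GE] : exists2 G, P G &
    forall t p, I t -> U p -> G t p = foldr (jderive I) F ds t p.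
  have [Gd Gc _] := HP G PG; split; last exact: within_congr GE Gc.
  move=> d t p It Up; have [l Gl] := Gd d t p It Up.
  by have [] := has_jdE It (has_jd_congr It Up GE Gl).
elim: ds => [|d ds [G PG GE]]; first by exists F.
have [_ _ /(_ d)[G1 PG1 G1E]] := HP G PG; exists G1 => // t p It Up /=.
by have [_ ->] := has_jdE It (has_jd_congr It Up GE (G1E t p It Up)).
Qed.

Lemma has_jd_lin d F G t p l m (a b : C) : I t -> U p ->
  has_jd I d F t p l -> has_jd I d G t p m ->
  has_jd I d (fun t p => a * F t p + b * G t p) t p (a * l + b * m).
Proof.
move=> It Up; case: d => [v|] /= Fl Gm.
  have D := rd_derivation v oU Up.
  exact: (drvD D (drvZ D a Fl) (drvZ D b Gm)).
have D := td_derivation (near_time_proper Ii I01 It) It.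
exact: (drvD D (drvZ D a Fl) (drvZ D b Gm)).
Qed.

Lemma jsmooth_lin F G (a b : C) : jsmooth I U F -> jsmooth I U G ->
  jsmooth I U (fun t p => a * F t p + b * G t p).
Proof.
move=> sF sG; apply: (jsmooth_coind (P := fun K => exists F G,
   [/\ jsmooth I U F, jsmooth I U G & K = (fun t p => a * F t p + b * G t p)]));
  last by exists F, G.
move=> _ {}[{}F [{}G [{}sF {}sG ->]]]; split.
- move=> d t p It Up; eexists.
  exact: (has_jd_lin a b It Up (jsmoothP d sF It Up) (jsmoothP d sG It Up)).
- move=> q; apply: cvgD; apply: cvgM; try exact: cvg_cst.
    exact: jsmooth_cont sF q.
  exact: jsmooth_cont sG q.
- move=> d; exists (fun t p => a * jderive I d F t p + b * jderive I d G t p).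
    exists (jderive I d F), (jderive I d G).
    by split; [exact: jsmooth_jderive sF | exact: jsmooth_jderive sG |].
  by move=> t p It Up; exact: (has_jd_lin a b It Up (jsmoothP d sF It Up) (jsmoothP d sG It Up)).
Qed.

(** Turns a partial derivative into a one-variable derivative within [J], the form needed for the
    Schwarz theorem: the limit is restricted to the displacements that [J] allows. *)
Lemma move_has_tderive d F t p (J : set R) x l :
  (forall y, J y -> I (move_t d t y)) ->
  has_jd I d F (move_t d t x) (move_p d p x) l ->
  has_tderive J (fun x => F (move_t d t x) (move_p d p x)) x l.
Proof.
case: d => [v|] /= JI; rewrite /has_tderive /tquot.
  move=> /cvg_within_filter => /(_ [set h | J (x + h)]).
  rewrite /rquot; apply: cvg_trans; apply: near_eq_cvg; apply: nearW => h.
  by rewrite -addrA -scalerDl -rmorphD.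
apply: cvg_trans => P; rewrite /near_time !near_simpl /within /=.
move=> H; apply: (@filterS _ (0 : R)^' _ _ _ _ H) => h {}H Jh; rewrite /= addrA; apply: H.
by rewrite -addrA; exact: JI.
Qed.

End Region.
End JointSmoothness.

Section Commutation.
Context {R : realType} {n : nat}.
Local Notation C := R[i].
Local Notation E := (model R n).
Implicit Types (f : E -> C) (F G : R -> E -> C) (v p : E).
Context (I : set R) (U : set E).
Hypotheses (Ii : is_interval I) (I01 : exists t0 t1, [/\ I t0, I t1 & t0 < t1])
  (oU : open U).

Lemma move_t0 d (t : R) : move_t (n := n) d t 0 = t.
Proof. by case: d => //=; rewrite addr0. Qed.

Lemma move_p0 d p : move_p d p 0 = p.
Proof. by case: d => //= v; rewrite scale0r addr0. Qed.

Lemma move_tC (d d' : option E) (t x y : R) :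
  move_t d' (move_t d t x) y = move_t d (move_t d' t y) x.
Proof. by case: d d' => [v|] [w|] //=; rewrite addrAC. Qed.

Lemma move_pC d d' p (x y : R) :
  move_p d' (move_p d p x) y = move_p d (move_p d' p y) x.
Proof. by case: d d' => [v|] [w|] //=; rewrite addrAC. Qed.

Lemma move_t_cvg d (T : Type) (F : set_system T) {FF : Filter F} (u x : T -> R) (t a : R) :
  u @ F --> t -> x @ F --> a ->
  (fun k => move_t (n := n) d (u k) (x k)) @ F --> move_t (n := n) d t a.
Proof.
case: d => [v|] /=; first by move=> ut _; exact: ut.
by move=> ut xa; exact: (cvgD ut xa).
Qed.

Lemma move_p_cvg d (T : Type) (F : set_system T) {FF : Filter F} (u : T -> E)
    (x : T -> R) p (a : R) :
  u @ F --> p -> x @ F --> a ->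
  (fun k => move_p d (u k) (x k)) @ F --> move_p d p a.
Proof.
case: d => [v|] /=; last by move=> up _; exact: up.
by move=> up xa; exact: (cvgD up (cvgZr_tmp (cvg_RtoC xa))).
Qed.

Let mt (d d' : option E) t (q : R * R) := move_t d' (move_t d t q.1) q.2.
Let mp (d d' : option E) p (q : R * R) := move_p d' (move_p d p q.1) q.2.

Lemma mt_cvg d d' t : mt d d' t q @[q --> ((0, 0) : R * R)] --> t.
Proof.
rewrite -[X in _ --> X](move_t0 d) -[X in _ --> X](move_t0 d').
apply: (@move_t_cvg d' _ (nbhs ((0, 0) : R * R))); last exact: cvg_snd.
by apply: (@move_t_cvg d _ (nbhs ((0, 0) : R * R))); [exact: cvg_cst | exact: cvg_fst].
Qed.

Lemma mp_cvg d d' p : mp d d' p q @[q --> ((0, 0) : R * R)] --> p.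
Proof.
rewrite -[X in _ --> X](move_p0 d) -[X in _ --> X](move_p0 d').
apply: (@move_p_cvg d' _ (nbhs ((0, 0) : R * R))); last exact: cvg_snd.
by apply: (@move_p_cvg d _ (nbhs ((0, 0) : R * R))); [exact: cvg_cst | exact: cvg_fst].
Qed.

Lemma nbhs00 (P : set (R * R)) : nbhs ((0, 0) : R * R) P ->
  exists2 r : R, 0 < r & forall x y, `|x| < r -> `|y| < r -> P (x, y).
Proof.
move=> /nbhs_ballP[r /= r0 rP]; exists r => // x y xr yr; apply: rP.
by split; rewrite /ball /= sub0r normrN.
Qed.

Lemma move_cont F d d' t p : I t -> U p ->
  {within I `*` U, continuous (fun q : R * E => F q.1 q.2)} ->
  forall e : R, 0 < e -> exists2 r : R, 0 < r & forall x y,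
    I (mt d d' t (x, y)) -> U (mp d d' p (x, y)) ->
    `|x| < r -> `|y| < r ->
    `|F t p - F (mt d d' t (x, y)) (mp d d' p (x, y))| < e%:C.
Proof.
move=> It Up /subspace_continuousP Fc e e0.
have {Fc} := Fc (t, p) (conj It Up).
move=> /cvgrPdist_lt /(_ e%:C); rewrite ltcR => /(_ e0) /= Fc.
have cp : (mt d d' t q, mp d d' p q) @[q --> ((0, 0) : R * R)] --> (t, p).
  exact: (@cvg_pair _ _ _ _ (nbhs t) (nbhs p) _ _ _ _ _ (@mt_cvg d d' t) (@mp_cvg d d' p)).
have /nbhs00[r r0 rP] := cp _ Fc; exists r => // x y Ix Uy xr yr.
by apply: rP => //; split.
Qed.

Lemma jderive_comm d d' F t p : jsmooth I U F -> I t -> U p ->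
  jderive I d (jderive I d' F) t p = jderive I d' (jderive I d F) t p.
Proof.
move=> sF It Up.
(* Two time displacements are thereby excluded; each could stay in [I] while their sum leaves it. *)
have [-> //|dd'] := eqVneq d d'.
(* Displacements below [dl] in both directions stay in [U]; [J] adds the constraint that time stays
   in [I]. *)
have [dl dl0 Udl] := nbhs00 (@mp_cvg d d' p _ (open_nbhs_nbhs (conj oU Up))).
pose J (d : option E) : set R := [set x | `|x| < dl /\ I (move_t d t x)].
have Jint c : is_interval (J c).
  move=> x y [xdl Ix] [ydl Iy] z /andP[xz zy]; split.
    move: xdl ydl; rewrite !ltr_norml => /andP[? ?] /andP[? ?].
    by apply/andP; split; lra.
  case: c Ix Iy => //= Ix Iy; apply: (Ii Ix Iy).
  by rewrite !lerD2l xz.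
have Jacc c : accum (J c).
  move=> r r0; have m0 : 0 < Num.min r dl by rewrite lt_min r0.
  case: c => [v|].
    exists (Num.min r dl / 2); rewrite gtr0_norm ?divr_gt0 //; split.
    - split => //=; rewrite gtr0_norm ?divr_gt0 //.
      apply: (lt_le_trans (y := Num.min r dl)); last by rewrite ge_min lexx orbT.
      by rewrite ltr_pdivrMr // ltr_pMr // ltr1n.
    - by rewrite gt_eqF ?divr_gt0.
    - apply: (lt_le_trans (y := Num.min r dl)); last by rewrite ge_min lexx.
      by rewrite ltr_pdivrMr // ltr_pMr // ltr1n.
  have PF := near_time_proper Ii I01 It.
  have : near_time I t [set h | h != 0 /\ `|h| < Num.min r dl /\ I (t + h)].
    have hm : \forall h \near (0 : R)^', `|h| < Num.min r dl.
      apply: cvg_within; apply/nbhs_ballP; exists (Num.min r dl) => //= h.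
      by rewrite /ball /= sub0r normrN.
    apply: (@filterS2 _ (0 : R)^' _ _ _ _ _ (nbhs_dnbhs_neq (0 : R)) hm).
    by move=> h h0 hr Ih.
  move=> /filter_ex[h [h0 [hm Ih]]]; exists h; split => //.
    by split => //; apply: lt_le_trans hm _; rewrite ge_min lexx orbT.
  by apply: lt_le_trans hm _; rewrite ge_min lexx.
have J0 c : J c 0 by split; rewrite ?normr0 ?move_t0.
have IJ x y : J d x -> J d' y -> I (mt d d' t (x, y)).
  by move=> [_ Ix] [_ Iy]; move: dd' Ix Iy; clear -It; case: d d' => [v|] [w|].
have UJ x y : J d x -> J d' y -> U (mp d d' p (x, y)).
  by move=> [xd _] [yd _]; exact: Udl.
have E00 G : G t p = G (mt d d' t (0, 0)) (mp d d' p (0, 0)).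
  by rewrite /mt /mp !move_t0 !move_p0.
have dx G x y : jsmooth I U G -> J d x -> J d' y ->
    has_tderive (J d) (fun x => G (mt d d' t (x, y)) (mp d d' p (x, y))) x
      (jderive I d G (mt d d' t (x, y)) (mp d d' p (x, y))).
  move=> sG Jx Jy; have := jsmoothP d sG (IJ x y Jx Jy) (UJ x y Jx Jy).
  rewrite /mt /mp /= move_tC move_pC => GE.
  have := move_has_tderive (J := J d) _ GE => /(_ _)/wrap[z Jz|].
    by have := IJ z y Jz Jy; rewrite /mt /= move_tC.
  congr has_tderive; apply/funext => z.
  by rewrite move_tC move_pC.
have dy G x y : jsmooth I U G -> J d x -> J d' y ->
    has_tderive (J d') (fun y => G (mt d d' t (x, y)) (mp d d' p (x, y))) y
      (jderive I d' G (mt d d' t (x, y)) (mp d d' p (x, y))).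
  move=> sG Jx Jy; have GE := jsmoothP d' sG (IJ x y Jx Jy) (UJ x y Jx Jy).
  by apply: (move_has_tderive (J := J d') _ GE) => z Jz; exact: (IJ x z Jx Jz).
have cont G : jsmooth I U G -> forall e : R, 0 < e -> exists2 r : R, 0 < r &
    forall x y, J d x -> J d' y -> `|x| < r -> `|y| < r ->
    `|G (mt d d' t (0, 0)) (mp d d' p (0, 0))
      - G (mt d d' t (x, y)) (mp d d' p (x, y))| < e%:C.
  move=> sG e e0; rewrite -E00.
  have [r r0 rP] := move_cont d d' It Up (jsmooth_cont sG) e0.
  by exists r => // x y Jx Jy; apply: rP; [exact: IJ | exact: UJ].
rewrite (E00 (jderive I d _)) (E00 (jderive I d' _)); apply/esym.
apply: (complex_schwarz (J1 := J d) (J2 := J d')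
  (g := fun x y => F (mt d d' t (x, y)) (mp d d' p (x, y)))
  (g1 := fun x y => jderive I d F (mt d d' t (x, y)) (mp d d' p (x, y)))
  (g2 := fun x y => jderive I d' F (mt d d' t (x, y)) (mp d d' p (x, y)))
  (g12 := fun x y => jderive I d' (jderive I d F) (mt d d' t (x, y)) (mp d d' p (x, y)))
  (g21 := fun x y => jderive I d (jderive I d' F) (mt d d' t (x, y)) (mp d d' p (x, y))))
  => //.
- by move=> x y; exact: dx.
- by move=> x y; exact: dy.
- by move=> x y; apply: dy; exact: jsmooth_jderive.
- by move=> x y; apply: dx; exact: jsmooth_jderive.
- by apply: cont; do 2 apply: jsmooth_jderive.
- by apply: cont; do 2 apply: jsmooth_jderive.
Qed.

End Commutation.

(** * Wirtinger derivatives *)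

Section Wirtinger.
Context {R : realType} {n : nat}.
Local Notation C := R[i].
Local Notation E := (model R n).
Implicit Types (f : E -> C) (F G : R -> E -> C) (v p : E) (s : bool).

(** [true] selects d/dzbar and [false] d/dz, so that conjugation acts on the kind of derivative by
    negation. *)
Definition wsign s : C := if s then 'i else - 'i.

Definition wirtinger s v f p : C :=
  (rderive v f p + wsign s * rderive ('i *: v) f p) / 2%:R.

Lemma dzE v f : dz v f = wirtinger false v f.
Proof. by apply/funext => p; rewrite /wirtinger mulNr. Qed.

Lemma dzbE v f : dzb v f = wirtinger true v f.
Proof. by []. Qed.

(** Existence of both real derivatives is part of the predicate; [wirtinger] alone is built from
    [lim], which has a value even without convergence. *)
Definition has_wd s v p f (l : C) := exists l1 l2,
  [/\ has_rd v p f l1, has_rd ('i *: v) p f l2 & l = (l1 + wsign s * l2) / 2%:R].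

Lemma has_rdE v p f l : has_rd v p f l -> rderive v f p = l.
Proof. exact: (cvg_lim (@norm_hausdorff _ _)). Qed.

Lemma has_wdE s v p f l : has_wd s v p f l -> wirtinger s v f p = l.
Proof. by move=> [l1 [l2 [/has_rdE h1 /has_rdE h2 ->]]]; rewrite /wirtinger h1 h2. Qed.

Lemma has_rd_conj v p f l : has_rd v p f l -> has_rd v p (fun q => (f q)^*) l^*.
Proof.
move=> /cvg_conjc; apply: cvg_trans; apply: near_eq_cvg; apply: nearW => h.
rewrite /rquot fmorph_div rmorphB /=; congr (_ / _).
by apply/eqP; rewrite eq_complex /= oppr0 !eqxx.
Qed.

Lemma has_wd_conj s v p f l :
  has_wd s v p f l -> has_wd (~~ s) v p (fun q => (f q)^*) l^*.
Proof.
move=> [l1 [l2 [h1 h2 ->]]]; exists l1^*, l2^*; split; try exact: has_rd_conj.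
rewrite fmorph_div rmorphD rmorphM /=; congr ((_ + _ * _) / _).
  by case: s; apply/eqP; rewrite eq_complex /= ?oppr0 ?opprK !eqxx.
by apply/eqP; rewrite eq_complex /= addr0 oppr0 !eqxx.
Qed.

(** A Wirtinger derivative is not a derivative along a curve, but every rule is linear in the
    derivatives and so passes to complex combinations of two real ones. *)
Lemma wd_derivation (U : set E) s v p : open U -> U p ->
  is_derivation U p (has_wd s v p).
Proof.
move=> oU Up.
have D1 := rd_derivation v oU Up; have D2 := rd_derivation ('i *: v) oU Up.
split.
- by move=> f l l' /has_wdE <- /has_wdE <-.
- move=> f g l fg [l1 [l2 [h1 h2 ->]]]; exists l1, l2; split.
  + exact: (drv_eq D1 fg h1).
  + exact: (drv_eq D2 fg h2).
  + by [].
- move=> c; exists 0, 0; split; [exact: drv_cst D1 c | exact: drv_cst D2 c |].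
  by rewrite mulr0 addr0 mul0r.
- move=> f g _ _ [l1 [l2 [h1 h2 ->]]] [m1 [m2 [k1 k2 ->]]].
  exists (l1 + m1), (l2 + m2); split.
  + exact: (drvD D1 h1 k1).
  + exact: (drvD D2 h2 k2).
  + by ring.
- move=> f g _ _ [l1 [l2 [h1 h2 ->]]] [m1 [m2 [k1 k2 ->]]].
  exists (l1 * g p + f p * m1), (l2 * g p + f p * m2); split.
  + exact: (drvM D1 h1 k1).
  + exact: (drvM D2 h2 k2).
  + by ring.
- move=> f _ f0 [l1 [l2 [h1 h2 ->]]].
  exists (- l1 / f p ^+ 2), (- l2 / f p ^+ 2); split.
  + exact: (drvV D1 f0 h1).
  + exact: (drvV D2 f0 h2).
  + by ring.
- move=> f _ f0 [l1 [l2 [h1 h2 ->]]].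
  exists (l1 / f p), (l2 / f p); split.
  + exact: (drv_ln D1 f0 h1).
  + exact: (drv_ln D2 f0 h2).
  + by ring.
Qed.

Lemma wirtinger_congr (U : set E) s v f g p : open U -> U p ->
  (forall q, U q -> f q = g q) -> wirtinger s v f p = wirtinger s v g p.
Proof.
move=> oU Up fg; rewrite /wirtinger /rderive.
have lE w : lim (rquot w f p h @[h --> 0^']) = lim (rquot w g p h @[h --> 0^']).
  have E0 : \forall h \near (0 : R)^', rquot w f p h = rquot w g p h.
    apply: cvg_within; apply: filterS (near_line w oU Up) => h Uh.
    by rewrite /rquot !fg.
  congr lim; apply/seteqP; split; apply: near_eq_cvg => //.
  by apply: filterS E0.
by rewrite !lE.
Qed.

Section Region.
Context (I : set R) (U : set E).
Hypotheses (Ii : is_interval I) (I01 : exists t0 t1, [/\ I t0, I t1 & t0 < t1])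
  (oU : open U).

Definition fam_wirtinger s v F t p : C := wirtinger s v (F t) p.

Lemma fam_wirtingerE s v F : fam_wirtinger s v F = fun t p =>
  2%:R^-1 * jderive I (Some v) F t p
  + (wsign s / 2%:R) * jderive I (Some ('i *: v)) F t p.
Proof.
apply/funext => t; apply/funext => p.
by rewrite /fam_wirtinger /wirtinger /jderive mulrDl mulrC mulrAC.
Qed.

Lemma jsmooth_wirtinger s v F : jsmooth I U F -> jsmooth I U (fam_wirtinger s v F).
Proof.
move=> sF; rewrite fam_wirtingerE.
exact: (jsmooth_lin Ii I01 oU _ _ (jsmooth_jderive _ sF) (jsmooth_jderive _ sF)).
Qed.

Lemma jsmooth_wd s v F t p : jsmooth I U F -> I t -> U p ->
  has_wd s v p (F t) (fam_wirtinger s v F t p).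
Proof.
move=> sF It Up; exists (rderive v (F t) p), (rderive ('i *: v) (F t) p).
split; [exact: (jsmoothP (Some v) sF It Up) |
  exact: (jsmoothP (Some ('i *: v)) sF It Up) | by []].
Qed.

Lemma jderive_wirtinger d s v F t p : jsmooth I U F -> I t -> U p ->
  has_jd I d (fam_wirtinger s v F) t p (fam_wirtinger s v (jderive I d F) t p).
Proof.
move=> sF It Up; rewrite !fam_wirtingerE.
have H w := jsmoothP d (jsmooth_jderive (Some w) sF) It Up.
have := has_jd_lin Ii I01 oU 2%:R^-1 (wsign s / 2%:R) It Up (H v) (H ('i *: v)).
by rewrite !(jderive_comm Ii I01 oU d _ sF It Up).
Qed.

Lemma fam_wirtingerC s v s' v' F t p : jsmooth I U F -> I t -> U p ->
  fam_wirtinger s v (fam_wirtinger s' v' F) t p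
  = fam_wirtinger s' v' (fam_wirtinger s v F) t p.
Proof.
move=> sF It Up.
have H d := (has_jdE Ii I01 It (jderive_wirtinger d s' v' sF It Up)).2.
rewrite [LHS]/fam_wirtinger /wirtinger.
rewrite -[rderive v _ p]/(jderive I (Some v) _ t p) H.
rewrite -[rderive ('i *: v) _ p]/(jderive I (Some ('i *: v)) _ t p) H.
apply/esym; apply: has_wdE.
have D := wd_derivation s' v' oU Up.
have K d := jsmooth_wd s' v' (jsmooth_jderive d sF) It Up.
have := drvD D (drvZ D 2%:R^-1 (K (Some v)))
  (drvZ D (wsign s / 2%:R) (K (Some ('i *: v)))).
set X := (X in has_wd _ _ _ _ X) => HX.
set Y := (Y in has_wd _ _ _ _ Y).
have -> : Y = X by rewrite /X /Y mulrDl mulrC mulrAC.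
apply: (drv_eq D _ HX) => q _.
by rewrite /fam_wirtinger /wirtinger /jderive mulrDl mulrC mulrAC.
Qed.

Definition iter_wirtinger (ds : seq (bool * E)) F :=
  foldr (fun d => fam_wirtinger d.1 d.2) F ds.

Lemma jsmooth_iter ds F : jsmooth I U F -> jsmooth I U (iter_wirtinger ds F).
Proof.
move=> sF; elim: ds => [|d ds IH] /=; first exact: sF.
exact: jsmooth_wirtinger IH.
Qed.

(** All symmetries of the third and fourth derivatives follow from this by exhibiting a permutation
    of the directions. *)
Lemma iter_wirtinger_perm ds ds' F t p : jsmooth I U F -> perm_eq ds ds' ->
  I t -> U p -> iter_wirtinger ds F t p = iter_wirtinger ds' F t p.
Proof.
move=> sF + It; elim: ds ds' p => [|d ds IH] ds' p.
  by rewrite perm_sym => /perm_nilP ->.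
move=> dd Up; have dds' : d \in ds' by rewrite -(perm_mem dd) mem_head.
move: dd; case/path.splitPr: dds' => e1 e2 dd.
have {}dd : perm_eq ds (e1 ++ e2).
  by rewrite -(perm_cons d) (perm_trans dd) // -cat1s perm_catCA.
transitivity (iter_wirtinger (d :: e1 ++ e2) F t p).
  by apply: (wirtinger_congr _ _ oU Up) => q Uq; exact: IH.
(* The direction [d] is moved past those in [e1], one commutation at a time. *)
elim: e1 p Up {IH dd} => [|e e1 IH] p Up; first reflexivity.
rewrite [LHS]/= (fam_wirtingerC _ _ _ _ (jsmooth_iter _ sF) It Up).
by apply: (wirtinger_congr _ _ oU Up) => q Uq; exact: IH.
Qed.

End Region.
End Wirtinger.

(** * The flow in local coordinates *)

Section LocalFlow.
Context {R : realType} {n : nat}.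
Local Notation C := R[i].
Local Notation E := (model R n).
Local Notation ix := (option 'I_n).

Definition frame (a : ix) : E := if a is Some i then ez i else es.

(* f_{a bbar}, with [None] standing for the index s. *)
Definition levi (f : E -> C) (p : E) (a b : ix) : C :=
  wirtinger false (frame a) (wirtinger true (frame b) f) p.

Lemma fib_levi f p : fib (levi f p) = hess f p.
Proof. by apply/matrixP => i j; rewrite !mxE dzE. Qed.

Lemma dbar_sE f p j : dbar_s f p j = levi f p None (Some j).
Proof. by rewrite /dbar_s dzE. Qed.

Lemma V_ofE f p i : V_of f p i = - liftl (levi f p) (Some i).
Proof.
rewrite /V_of /= opprK; apply: eq_bigr => j _.
by rewrite fib_levi dbar_sE /hinv mxE.
Qed.

Context (I : set R) (U : set E).
Hypotheses (Ii : is_interval I) (I01 : exists t0 t1, [/\ I t0, I t1 & t0 < t1])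
  (oU : open U).
Context (F : R -> E -> C).
Hypotheses (Freal : forall t p, (F t p)^* = F t p)
  (sF : jsmooth I U F) (Fpos : forall t p, I t -> U p -> posdef (hess (F t) p)).

(** Conjugation turns d_a dbar_b f into dbar_a d_b f as f is real; then the two derivatives are
    commuted. *)
Lemma levi_conj t p a b : I t -> U p -> (levi (F t) p a b)^* = levi (F t) p b a.
Proof.
move=> It Up; pose Wb := fam_wirtinger true (frame b) F.
have sWb : jsmooth I U Wb := jsmooth_wirtinger Ii I01 oU _ _ sF.
have H := has_wd_conj (jsmooth_wd false (frame a) sWb It Up).
have {}H := drv_eq (wd_derivation true (frame a) oU Up)
  (g := wirtinger false (frame b) (F t)) _ H.
rewrite -(has_wdE (H _)).
  exact: (fam_wirtingerC Ii I01 oU true (frame a) false (frame b) sF It Up).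
move=> q Uq; apply/esym/has_wdE.
have := has_wd_conj (jsmooth_wd true (frame b) sF It Uq).
by rewrite (_ : (fun r => (F t r)^*) = F t) //; apply/funext.
Qed.

Lemma hess_conj t p i j : I t -> U p -> (hess (F t) p i j)^* = hess (F t) p j i.
Proof. by move=> It Up; rewrite -fib_levi !mxE levi_conj. Qed.

Lemma det_hess_gt0 t p : I t -> U p -> 0 < \det (hess (F t) p).
Proof.
move=> It Up; apply: posdef_det_gt0; last exact: Fpos.
by move=> i j; exact: hess_conj.
Qed.

Lemma fib_unit t p : I t -> U p -> fib (levi (F t) p) \in unitmx.
Proof.
by move=> It Up; rewrite fib_levi unitmxE unitfE gt_eqF // det_hess_gt0.
Qed.

Lemma c_ofE t p : I t -> U p -> c_of (F t) p = schur (levi (F t) p).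
Proof.
move=> It Up; rewrite /c_of /schur dzE; congr (_ - _).
apply: eq_bigr => i _; apply: eq_bigr => j _.
by rewrite fib_levi !dbar_sE -[Num.conj _]/(conjc _) levi_conj // /hinv mxE.
Qed.

Lemma liftl_conj t p a : I t -> U p ->
  (liftl (levi (F t) p) a)^* = liftr (levi (F t) p) a.
Proof.
move=> It Up; case: a => [i|]; rewrite /liftl /liftr; last first.
  by apply/eqP; rewrite eq_complex /= oppr0 !eqxx.
rewrite rmorphN rmorph_sum; congr (- _); apply: eq_bigr => j _.
rewrite rmorphM /= levi_conj // fib_levi conj_invmx //.
by move=> k l; exact: hess_conj.
Qed.

Lemma jsmooth_levi a b : jsmooth I U (fun t p => levi (F t) p a b).
Proof.
exact: (jsmooth_iter Ii I01 oU [:: (false, frame a); (true, frame b)] sF).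
Qed.

Lemma levi_wd s v t p a b : I t -> U p ->
  has_wd s v p (fun q => levi (F t) q a b)
    (wirtinger s v (fun q => levi (F t) q a b) p).
Proof. by move=> It Up; exact: (jsmooth_wd s v (jsmooth_levi a b) It Up). Qed.

Let dG t k a b p := wirtinger false (frame k) (fun q => levi (F t) q a b) p.
Let dbG t l a b p := wirtinger true (frame l) (fun q => levi (F t) q a b) p.
Let ddG t k l a b p := wirtinger false (frame k) (dbG t l a b) p.

Lemma dbG_wd v t l a b p : I t -> U p ->
  has_wd false v p (dbG t l a b) (wirtinger false v (dbG t l a b) p).
Proof.
move=> It Up; have sl := jsmooth_wirtinger Ii I01 oU true (frame l) (jsmooth_levi a b).
exact: (jsmooth_wd false v sl It Up).
Qed.

Let iterP := iter_wirtinger_perm Ii I01 oU.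

Lemma dG_sym t k a b p : I t -> U p -> dG t k a b p = dG t a k b p.
Proof.
move=> It Up.
apply: (iterP (ds := [:: (false, frame k); (false, frame a); (true, frame b)])
  (ds' := [:: (false, frame a); (false, frame k); (true, frame b)]) sF _ It Up).
exact: (permEl (perm_catCA [:: (false, frame k)] [:: (false, frame a)] _)).
Qed.

Lemma dbG_sym t l a b p : I t -> U p -> dbG t l a b p = dbG t b a l p.
Proof.
move=> It Up.
apply: (iterP (ds := [:: (true, frame l); (false, frame a); (true, frame b)])
  (ds' := [:: (true, frame b); (false, frame a); (true, frame l)]) sF _ It Up).
exact: (permEl (perm_rev [:: (true, frame b); (false, frame a); (true, frame l)])).
Qed.

Lemma ddG_sym t k l a b p : I t -> U p -> ddG t k l a b p = ddG t a b k l p.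
Proof.
move=> It Up.
pose kl := [:: (false, frame k); (true, frame l)].
pose ab := [:: (false, frame a); (true, frame b)].
apply: (iterP (ds := kl ++ ab) (ds' := ab ++ kl) sF _ It Up).
exact: (permEl (perm_catC kl ab)).
Qed.

Lemma schur_wd s v t p : I t -> U p ->
  has_wd s v p (fun q => c_of (F t) q)
    (\sum_a \sum_b liftl (levi (F t) p) a * liftr (levi (F t) p) b
       * wirtinger s v (fun q => levi (F t) q a b) p).
Proof.
move=> It Up; have D := wd_derivation s v oU Up.
apply: (drv_eq D (f := fun q => schur (levi (F t) q))).
  by move=> q Uq; rewrite c_ofE.
apply: (drv_schur Up D (G := fun q => levi (F t) q)) => [q Uq|a b].
  exact: fib_unit.
exact: levi_wd.
Qed.

(** The formula for dbar_l c holds on all of [U], hence can be differentiated again; only this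
    second derivative sees the derivatives of the lifts. *)
Lemma laplacian_c_of t p (dl dr : 'I_n -> ix -> C) : I t -> U p ->
  (forall k a, has_wd false (frame (Some k)) p (fun q => liftl (levi (F t) q) a) (dl k a)) ->
  (forall k a, has_wd false (frame (Some k)) p (fun q => liftr (levi (F t) q) a) (dr k a)) ->
  laplacian (F t) (c_of (F t)) p =
  \sum_k \sum_l invmx (hess (F t) p) l k *
     \sum_a \sum_b ((dl k a * liftr (levi (F t) p) b
                      + liftl (levi (F t) p) a * dr k b) * dbG t (Some l) a b p
                    + liftl (levi (F t) p) a * liftr (levi (F t) p) b
                      * ddG t (Some k) (Some l) a b p).
Proof.
move=> It Up Hdl Hdr; rewrite /laplacian; apply: eq_bigr => k _; apply: eq_bigr => l _.
rewrite /hinv !mxE; congr (_ * _); rewrite dzE dzbE.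
have D := wd_derivation false (frame (Some k)) oU Up.
apply: has_wdE; apply: (drv_eq D
  (f := fun q => \sum_a \sum_b liftl (levi (F t) q) a * liftr (levi (F t) q) b
       * dbG t (Some l) a b q)).
  by move=> q Uq; rewrite (has_wdE (schur_wd true (frame (Some l)) It Uq)).
apply: (drv_sum D) => a; apply: (drv_sum D) => b.
exact: (drvM D (drvM D (Hdl k a) (Hdr k b)) (dbG_wd _ _ _ _ It Up)).
Qed.

Section Flow.
Context (m c0 : C).
Hypotheses (c0pos : 0 < c0)
  (KRF : forall t p, I t -> U p -> jderive I None F t p =
     (ln (complex.Re (\det (c0 *: hess (F t) p))))%:C - m * F t p).

Let psi := jderive I None F.

(** The normalization [c0] of dd^c cancels between the inverse of [c0 *: hess] and its
    derivative. *)
Lemma psi_wd s v t p : I t -> U p ->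
  has_wd s v p (psi t)
    (\sum_i \sum_j invmx (hess (F t) p) j i
        * wirtinger s v (fun q => levi (F t) q (Some i) (Some j)) p
     - m * wirtinger s v (F t) p).
Proof.
move=> It Up; have D := wd_derivation s v oU Up.
have := @drvB _ _ U p _ D _ _ _ _
  (drv_ln_det Up D (M := fun q => c0 *: hess (F t) q)
     (L := c0 *: \matrix_(i, j) wirtinger s v (fun q => levi (F t) q (Some i) (Some j)) p)
     _ _) (drvZ D m (jsmooth_wd s v sF It Up)).
have dpos q : U q -> 0 < \det (c0 *: hess (F t) q).
  by move=> Uq; rewrite detZ mulr_gt0 ?exprn_gt0 // det_hess_gt0.
move=> /(_ dpos) H.
have {H} := drv_eq D (g := psi t) _ (H _).
set S := (X in _ -> _ -> has_wd _ _ _ _ (X - _)) => H.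
rewrite (_ : (\sum_i _) = S).
  apply: H => [q Uq|i j]; first by rewrite /psi KRF.
  rewrite mxE [(\matrix_(i, j) _) _ _]mxE.
  apply: (drv_eq D _ (drvZ D c0 (levi_wd s v (Some i) (Some j) It Up))) => q Uq.
  by rewrite -fib_levi !mxE.
rewrite /S invmxZ; last by rewrite unitmxE unitfE gt_eqF // dpos.
apply: eq_bigr => i _; apply: eq_bigr => j _; rewrite !mxE.
by field; rewrite gt_eqF.
Qed.

(** The derivative d_a of the inverse Hessian yields the quadratic term in third derivatives. *)
Lemma levi_psi t p a b : I t -> U p -> levi (psi t) p a b =
  \sum_i \sum_j
      ((- (invmx (hess (F t) p) *m (\matrix_(k, l) dG t a (Some k) (Some l) p)
            *m invmx (hess (F t) p))) j i * dbG t b (Some i) (Some j) p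
       + invmx (hess (F t) p) j i * ddG t a b (Some i) (Some j) p)
  - m * levi (F t) p a b.
Proof.
move=> It Up; have D := wd_derivation false (frame a) oU Up.
apply: has_wdE; apply: (drv_eq D (f := fun q =>
  \sum_i \sum_j invmx (hess (F t) q) j i * dbG t b (Some i) (Some j) q
  - m * wirtinger true (frame b) (F t) q)).
  by move=> q Uq; rewrite (has_wdE (psi_wd true (frame b) It Uq)).
have sb := jsmooth_wirtinger Ii I01 oU true (frame b) sF.
apply: (drvB D _ (drvZ D m (jsmooth_wd false (frame a) sb It Up))).
apply: (drv_sum D) => i; apply: (drv_sum D) => j.
apply: (drvM D _ (dbG_wd _ _ _ _ It Up)).
apply: (drv_invmx Up D (M := fun q => hess (F t) q)) => [q Uq|k l].
  by rewrite -fib_levi fib_unit.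
rewrite mxE.
apply: (drv_eq D _ (levi_wd false (frame a) (Some k) (Some l) It Up)) => q Uq.
by rewrite -fib_levi mxE.
Qed.

Lemma td_levi t p a b : I t -> U p ->
  has_tderive I (fun tau => levi (F tau) p a b) t (levi (psi t) p a b).
Proof.
move=> It Up; have sb := jsmooth_wirtinger Ii I01 oU true (frame b) sF.
have := jderive_wirtinger Ii I01 oU None false (frame a) sb It Up.
congr (has_tderive _ _ _ _); apply: (wirtinger_congr _ _ oU Up) => q Uq.
exact: (has_jdE Ii I01 It (jderive_wirtinger Ii I01 oU None true (frame b) sF It Uq)).2.
Qed.

Lemma local_flow t p : I t -> U p ->
  has_tderive I (fun tau => c_of (F tau) p) t
    (laplacian (F t) (c_of (F t)) p - m * c_of (F t) p + normA2 (F t) p).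
Proof.
move=> It Up.
have DT := td_derivation (near_time_proper Ii I01 It) It.
have Gu q : U q -> fib (levi (F t) q) \in unitmx by exact: fib_unit.
have : has_tderive I (fun tau => c_of (F tau) p) t
    (\sum_a \sum_b liftl (levi (F t) p) a * liftr (levi (F t) p) b * levi (psi t) p a b).
  apply: (drv_eq DT (f := fun tau => schur (levi (F tau) p))).
    by move=> tau Itau; rewrite c_ofE.
  apply: (drv_schur It DT (G := fun tau => levi (F tau) p)) => [tau Itau|a b].
    exact: fib_unit.
  exact: td_levi.
congr (has_tderive _ _ _ _).
have L s v := drv_liftl Up (wd_derivation s v oU Up) Gu (fun a b => levi_wd s v a b It Up).
have Rt s v := drv_liftr Up (wd_derivation s v oU Up) Gu (fun a b => levi_wd s v a b It Up).
have [dl dlP] := choice (fun k => L false (frame (Some k))).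
have [dr drP] := choice (fun k => Rt false (frame (Some k))).
have [dbl dblP] := choice (fun k => L true (frame (Some k))).
have [dbr dbrP] := choice (fun k => Rt true (frame (Some k))).
rewrite (laplacian_c_of It Up (dl := dl) (dr := dr)); last 2 first.
- by move=> k a; have [_ H _] := dlP k; exact: H.
- by move=> k a; have [_ H _] := drP k; exact: H.
(* The part of the flow linear in the weight, contracted with the lifts, is [m] times c again. *)
under eq_bigr do under eq_bigr do rewrite levi_psi // mulrBr mulrCA.
under eq_bigr do rewrite sumrB -mulr_sumr.
rewrite sumrB -mulr_sumr -schurE ?Gu // -c_ofE // [RHS]addrAC; congr (_ - _).
have -> : normA2 (F t) p = \sum_i \sum_j \sum_k \sum_l
    hess (F t) p i k * invmx (hess (F t) p) j l * dbl j (Some i) * dr l (Some k).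
  rewrite /normA2; apply: eq_bigr => i _; apply: eq_bigr => j _.
  apply: eq_bigr => k _; apply: eq_bigr => l _.
  (* V is minus the vertical part of W, so the two signs cancel and A is dbar W. *)
  have AE r q : A_of (F t) p r q = dbl q (Some r).
    rewrite /A_of dzbE; have [_ H _] := dblP q.
    rewrite (_ : V_of (F t) ^~ r = fun x => - liftl (levi (F t) x) (Some r)).
      have D := wd_derivation true (ez q) oU Up.
      by rewrite (has_wdE (drvN D (H (Some r)))) opprK.
    by apply/funext => x; rewrite V_ofE.
  rewrite !AE; congr (_ * _ * _ * _); first by rewrite /hinv mxE.
  (* The conjugate of dbar_l W is d_l of the conjugate of W, by uniqueness of derivatives. *)
  have [_ H _] := dblP l; have [_ H' _] := drP l.
  have D := wd_derivation false (frame (Some l)) oU Up.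
  apply: (drv_uniq D _ (H' (Some k))).
  apply: (drv_eq D _ (has_wd_conj (H (Some k)))) => q Uq.
  exact: liftl_conj.
have GE i j : hess (F t) p i j = levi (F t) p (Some i) (Some j).
  by rewrite -fib_levi mxE.
apply/esym.
have := @curvature_identity C n (liftl (levi (F t) p)) (liftr (levi (F t) p))
  (hess (F t) p) (fun k a b => dG t k a b p) (fun k a b => dbG t k a b p)
  (fun k l a b => ddG t k l a b p) dl dbl dr dbr.
apply.
- by rewrite -fib_levi Gu.
- by move=> k; have [H _ _] := dlP k.
- by move=> k; have [H _ _] := drP k.
- move=> k j; under [X in _ + X]eq_bigr do rewrite GE.
  by have [_ _ E] := dlP k; exact: E.
- move=> l j; under [X in _ + X]eq_bigr do rewrite GE.
  by have [_ _ E] := dblP l; exact: E.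
- move=> l i; under [X in _ + X]eq_bigr do rewrite GE.
  by have [_ _ E] := dbrP l; exact: E.
- by move=> k a b; exact: dG_sym.
- by move=> l a b; exact: dbG_sym.
- by move=> k l a b; exact: ddG_sym.
Qed.

End Flow.
End LocalFlow.

(** * From local coordinates to weights on the family *)

Section FlowWeights.
Context {R : realType} {n : nat} {X : topologicalType}.
Local Notation C := R[i].

Lemma MA_factor_gt0 : (0 : C) < ((2%:R * pi : R)^-1)%:C.
Proof. by rewrite ltcR invr_gt0 mulr_gt0 // pi_gt0. Qed.

(** In one adapted chart this is [local_flow] with [m] equal to the sign and [c0] to 1/(2 pi); the
    logarithm of the quotient of densities splits because both are positive. *)
Lemma flow_c_of (A : set (chart R n X)) (q : X -> C) (e : bool) (I : set R)
    (phi : R -> local_fun (R := R) (n := n) (X := X) R) :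
  is_interval I -> (exists t0 t1, [/\ I t0, I t1 & t0 < t1]) ->
  weights A q e I phi -> relative_KRF A q e I phi ->
  forall t a p, I t -> adapted A q a -> img a p ->
    has_tderive I (fun tau => c_of (toC (phi tau) a) p) t
      (laplacian (toC (phi t) a) (c_of (toC (phi t) a)) p
       - (pm e)%:~R * c_of (toC (phi t) a) p + normA2 (toC (phi t) a) p).
Proof.
move=> Ii I01 [sphi phipos _] KRF t a p It aa Up.
have oU : open (img a) by case: aa => -[].
have sF := sphi a aa.
have Fpos s r : I s -> img a r -> posdef (hess (toC (phi s) a) r).
  by move=> Is Ur; exact: phipos.
have Freal s r : (toC (phi s) a r)^* = toC (phi s) a r by exact: conjc_real.
apply: (local_flow Ii I01 oU Freal sF Fpos MA_factor_gt0 _ It Up) => s r Is Ur.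
have [_ ->] := has_jdE (d := None) (F := fun s => toC (phi s) a) (p := r)
  Ii I01 Is (KRF s a r Is aa Ur).
have : 0 < \det (((2%:R * pi)^-1)%:C *: hess (toC (phi s) a) r).
  by rewrite detZ mulr_gt0 ?exprn_gt0 ?MA_factor_gt0 ?(det_hess_gt0 Ii I01 oU Freal sF Fpos).
rewrite ltcE /= => /andP[_ dpos].
rewrite /MA_density /exp_density ln_div ?posrE ?expR_gt0 // expRK.
by rewrite rmorphB rmorphM /= rmorph_int.
Qed.

End FlowWeights.

Unset Implicit Arguments.

Theorem theorem34 (R : realType) (n : nat) (X : topologicalType)
  (A : set (chart R n X)) (pi : X -> R[i]) (S : set R[i]) (e : bool)
  (hX : complex_manifold A) (hS : domain S) (hpi : proper_submersion A pi S)
  (hample : relatively_ample A pi S e)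
  (hvol : normalized_volume A pi S e) :
  (forall (I : set R) (phi : R -> local_fun (R := R) (n := n) (X := X) R),
     is_interval I -> (exists t0 t1, [/\ I t0, I t1 & t0 < t1]) ->
     weights A pi e I phi -> relative_KRF A pi e I phi ->
     forall t a p, I t -> adapted A pi a -> img a p ->
       has_tderive I (fun tau => c_of (toC (phi tau) a) p) t
         (laplacian (toC (phi t) a) (c_of (toC (phi t) a)) p
          - (pm e)%:~R * c_of (toC (phi t) a) p
          + normA2 (toC (phi t) a) p)) /\
  (forall phiKE : local_fun (R := R) (n := n) (X := X) R,
     weight A pi e phiKE -> normalized_KE A pi e phiKE ->
     forall a p, adapted A pi a -> img a p ->
       laplacian (toC phiKE a) (c_of (toC phiKE a)) p
       - (pm e)%:~R * c_of (toC phiKE a) p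
       + normA2 (toC phiKE a) p = 0).
Proof.
split; first exact: flow_c_of.
move=> phi wphi KE a p aa Up.
have Ii : is_interval [set: R] by [].
have I01 : exists t0 t1 : R, [/\ [set: R] t0, [set: R] t1 & t0 < t1].
  by exists 0, 1; rewrite ltr01.
have D := td_derivation (t := 0) (near_time_proper Ii I01 Logic.I) Logic.I.
(* The two densities agree, so the logarithm of their quotient is 0, the derivative of a constant
   family. *)
have KRF : relative_KRF A pi e [set: R] (fun=> phi).
  move=> t b q _ bb Uq; rewrite -KE // divff ?gt_eqF ?expR_gt0 // ln1.
  exact: (drv_cst (td_derivation (near_time_proper Ii I01 Logic.I) Logic.I)).
(* The right side of the evolution equation is now a time derivative of a constant, hence 0 by
   uniqueness. *)
have := flow_c_of Ii I01 wphi KRF (t := 0) Logic.I aa Up.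
by move=> /(drv_uniq D); apply; exact: drv_cst D _.
Qed.
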